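(* Let $F=\frac1n\sum_{i=1}^nF_i$ be $\mu$-quasi-strongly monotone with $\mu>0$. Assume that there is $\widehat\ell>0$ such that for all $x\in\mathbb{R}^d$, with $x^*=\mathrm{proj}_{X^*}(x)$, $$\frac1n\sum_{i=1}^n\|F_i(x)-F_i(x^* )\|^2\le\widehat\ell\,\langle F(x)-F(x^* ),x-x^*\rangle,$$ that $X^*=\{x^*\}$ is a singleton, and that for all $i\in\{1,\dots,n\}$, $k\ge0$, $\mathbb{E}_k[g_i^k]=F_i(x^k)$ and $\mathbb{E}_k\|g_i^k-F_i(x^k)\|^2\le\sigma_i^2$. Let $0<\alpha\le\frac1{1+\omega}$ and $$0<\gamma\le\frac{1}{\left(1+\frac{6\omega}{n}\right)\widehat\ell}.$$ Then for all $k\ge0$ the iterates produced by DIANA-SGDA satisfy $$\mathbb{E}\|x^k-x^*\|^2\le\left(1-\min\left\{\gamma\mu,\frac\alpha2\right\}\right)^k\mathbb{E}[V_0]+\frac{\gamma^2\sigma^2(1+5\omega)}{n\cdot\min\{\gamma\mu,\alpha/2\}},$$ where $V_0=\|x^0-x^*\|^2+\frac{4\omega\gamma^2\sigma_0^2}{\alpha n}$, $\sigma_0^2=\frac1n\sum_{i=1}^n\|h_i^0-F_i(x^* )\|^2$ and $\sigma^2=\frac1n\sum_{i=1}^n\sigma_i^2$.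
   Context: Norms and inner products on $\mathbb{R}^d$ are Euclidean. $F,F_1,\dots,F_n:\mathbb{R}^d\to\mathbb{R}^d$ are operators and $R:\mathbb{R}^d\to\mathbb{R}\cup\{+\infty\}$ is a proper lower semicontinuous convex function. $X^*$ is the (nonempty) set of solutions of the regularized variational inequality: find $x^*\in\mathbb{R}^d$ with $\langle F(x^* ),x-x^*\rangle+R(x)-R(x^* )\ge0$ for all $x\in\mathbb{R}^d$. $\mathrm{proj}_{X^*}(x)=\arg\min_{y\in X^*}\|y-x\|$. $F$ is $\mu$-quasi-strongly monotone if $\langle F(x)-F(x^* ),x-x^*\rangle\ge\mu\|x-x^*\|^2$ for all $x\in\mathbb{R}^d$, where $x^*=\mathrm{proj}_{X^*}(x)$. An unbiased compressor (quantization) with parameter $\omega\ge0$ is a possibly randomized map $\mathcal{Q}:\mathbb{R}^d\to\mathbb{R}^d$ with $\mathbb{E}[\mathcal{Q}(x)]=x$ and $\mathbb{E}\|\mathcal{Q}(x)-x\|^2\le\omega\|x\|^2$ for all $x$. DIANA-SGDA, with stepsizes $\gamma,\alpha>0$, such a $\mathcal{Q}$, starting points $x^0,h_1^0,\dots,h_n^0\in\mathbb{R}^d$, $h^0=\frac1n\sum_ih_i^0$: at iteration $k$, each $i=1,\dots,n$ computes a stochastic estimate $g_i^k$ of $F_i(x^k)$ and sets $\Delta_i^k=g_i^k-h_i^k$, $h_i^{k+1}=h_i^k+\alpha\mathcal{Q}(\Delta_i^k)$; then $$g^k=h^k+\frac1n\sum_{i=1}^n\mathcal{Q}(\Delta_i^k),\quad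 h^{k+1}=h^k+\frac\alpha n\sum_{i=1}^n\mathcal{Q}(\Delta_i^k)=\frac1n\sum_{i=1}^nh_i^{k+1},\quad x^{k+1}=\mathrm{prox}_{\gamma R}(x^k-\gamma g^k),$$ where $\mathrm{prox}_{\gamma R}(x)=\arg\min_{y}\{R(y)+\|y-x\|^2/(2\gamma)\}$ and the same realization of $\mathcal{Q}(\Delta_i^k)$ is used in all updates. Given the past, $g_1^k,\dots,g_n^k$ are independent, and given these the vectors $\mathcal{Q}(\Delta_1^k),\dots,\mathcal{Q}(\Delta_n^k)$ are independent. $\mathbb{E}_k[\cdot]$ is the expectation with respect to the randomness at iteration $k$, i.e. conditional on everything generated before iteration $k$ (in particular on $x^k$ and the $h_i^k$). *)

(* Defs.v *)
From HB Require Import structures.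
From mathcomp Require Import all_boot all_order all_algebra.
From mathcomp Require Import all_classical all_reals all_analysis.
Set Implicit Arguments.
Unset Strict Implicit.
Unset Printing Implicit Defensive.
Import Order.TTheory GRing.Theory Num.Theory.
Import numFieldNormedType.Exports.
Local Open Scope classical_set_scope.
Local Open Scope ring_scope.

(* The library's norm `|x| on 'rV[R]_m is the sup norm; the Euclidean one is
   used here. *)
Definition dotv (R : realType) (m : nat) (u v : 'rV[R]_m) : R :=
  \sum_(j < m) u 0 j * v 0 j.

Definition enorm (R : realType) (m : nat) (u : 'rV[R]_m) : R :=
  Num.sqrt (dotv u u).

Definition average (R : realType) (m n : nat) (u : 'I_n -> 'rV[R]_m) :
  'rV[R]_m := n%:R^-1 *: \sum_(i < n) u i.

(* Matrices carry the product sigma-algebra generated by the entries; on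
   'rV[R]_m with R : realType this is the Borel sigma-algebra. *)
Definition measure_mx_display : measure_display -> measure_display.
Proof. exact. Qed.

Section measurable_matrix.
Context {disp : measure_display} {T : measurableType disp}.
Variables m n : nat.

Definition mx_sigma_algebra : set (set 'M[T]_(m, n)) :=
  <<s \bigcup_(ij in [set: 'I_m * 'I_n])
        preimage_set_system setT (fun A : 'M[T]_(m, n) => A ij.1 ij.2)
          measurable >>.

Let mx_set0 : mx_sigma_algebra set0.
Proof. exact: sigma_algebra0. Qed.

Let mx_setC A : mx_sigma_algebra A -> mx_sigma_algebra (~` A).
Proof. exact: sigma_algebraC. Qed.

Let mx_bigcup (F : (set 'M[T]_(m, n))^nat) :
  (forall i, mx_sigma_algebra (F i)) -> mx_sigma_algebra (\bigcup_i (F i)).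
Proof. exact: sigma_algebra_bigcup. Qed.

HB.instance Definition _ := @isMeasurable.Build (measure_mx_display disp)
  'M[T]_(m, n) mx_sigma_algebra mx_set0 mx_setC mx_bigcup.
End measurable_matrix.

(* Convex optimization *)

Definition is_argmin (T : Type) (disp : Order.disp_t) (U : porderType disp)
    (A : set T) (f : T -> U) (y : T) : Prop :=
  A y /\ forall z, A z -> (f y <= f z)%O.

Definition is_proj (R : realType) (m : nat) (X : set 'rV[R]_m)
    (x y : 'rV[R]_m) : Prop :=
  is_argmin X (fun z => enorm (z - x)) y.

Definition is_prox (R : realType) (m : nat) (gamma : R)
    (reg : 'rV[R]_m -> \bar R) (x y : 'rV[R]_m) : Prop :=
  is_argmin setT
    (fun z => reg z + (enorm (z - x) ^+ 2 / (2 * gamma))%:E)%E y.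

(* A proper function does not take the value -oo. *)
Definition proper_fun (R : realType) (m : nat) (reg : 'rV[R]_m -> \bar R) :
  Prop :=
  (forall x, reg x != -oo%E) /\ exists x, (reg x < +oo)%E.

Definition convex_efun (R : realType) (m : nat) (reg : 'rV[R]_m -> \bar R) :
  Prop :=
  forall (x y : 'rV[R]_m) (t : R), 0 <= t -> t <= 1 ->
    (reg (t *: x + (1 - t) *: y)%R <= t%:E * reg x + (1 - t)%:E * reg y)%E.

(* With the library's convention +oo - +oo = -oo, a solution necessarily has
   reg xs finite whenever reg is proper. *)
Definition VI_solutions (R : realType) (m : nat)
    (F : 'rV[R]_m -> 'rV[R]_m) (reg : 'rV[R]_m -> \bar R) : set 'rV[R]_m :=
  [set xs | forall x, (0 <= (dotv (F xs) (x - xs))%:E + reg x - reg xs)%E].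

Definition quasi_strongly_monotone (R : realType) (m : nat) (mu : R)
    (F : 'rV[R]_m -> 'rV[R]_m) (X : set 'rV[R]_m) : Prop :=
  forall x xs, is_proj X x xs ->
    mu * enorm (x - xs) ^+ 2 <= dotv (F x - F xs) (x - xs).

Definition average_star_cocoercive (R : realType) (m n : nat) (ell : R)
    (Fi : 'I_n -> 'rV[R]_m -> 'rV[R]_m) (X : set 'rV[R]_m) : Prop :=
  let F := fun x => average (fun i => Fi i x) in
  forall x xs, is_proj X x xs ->
    n%:R^-1 * (\sum_(i < n) enorm (Fi i x - Fi i xs) ^+ 2)
      <= ell * dotv (F x - F xs) (x - xs).

(* A randomized map is given by the probability kernel x |-> law of Q(x). *)
Definition unbiased_compressor (R : realType) (m : nat) (omega : R)
    (Q : R.-pker 'rV[R]_m ~> 'rV[R]_m) : Prop :=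
  forall x : 'rV[R]_m,
    (forall j : 'I_m,
       (Q x).-integrable setT (fun y : 'rV[R]_m => (y 0 j)%:E) /\
       (\int[Q x]_y ((y : 'rV[R]_m) 0 j)%:E = (x 0 j)%:E)%E) /\
    (\int[Q x]_y (enorm ((y : 'rV[R]_m) - x) ^+ 2)%:E
       <= (omega * enorm x ^+ 2)%:E)%E.

(* Conditioning on a sub-sigma-algebra G *)

Section conditioning.
Context {disp : measure_display} {Omega : measurableType disp} {R : realType}.
Variable P : probability Omega R.

Definition measurable_wrt (disp' : measure_display) (T : measurableType disp')
    (G : set (set Omega)) (X : Omega -> T) : Prop :=
  preimage_set_system setT X measurable `<=` G.

(* Y is a version of E[X | G]. *)
Definition is_cond_expectation (G : set (set Omega)) (X Y : Omega -> R) : Prop :=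
  [/\ P.-integrable setT (EFin \o X),
      P.-integrable setT (EFin \o Y),
      measurable_wrt G Y
    & forall A, G A ->
        (\int[P]_(w in A) (X w)%:E = \int[P]_(w in A) (Y w)%:E)%E].

Definition is_cond_expectation_rV (m : nat) (G : set (set Omega))
    (X Y : Omega -> 'rV[R]_m) : Prop :=
  forall j : 'I_m,
    is_cond_expectation G (fun w => X w 0 j) (fun w => Y w 0 j).

(* E[X | G] <= c almost surely. *)
Definition cond_expectation_le (G : set (set Omega)) (X : Omega -> R) (c : R) :
  Prop :=
  exists2 Y, is_cond_expectation G X Y & {ae P, forall w, Y w <= c}.

(* Conditional independence given G: almost surely,
   P(X_i \in B_i for all i | G) = \prod_i P(X_i \in B_i | G).  Taking B_i = setT
   gives the product rule for subfamilies. *)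
Definition cond_independent (n m : nat) (G : set (set Omega))
    (X : 'I_n -> Omega -> 'rV[R]_m) : Prop :=
  forall B : 'I_n -> set 'rV[R]_m, (forall i, measurable (B i)) ->
  exists2 p : 'I_n -> Omega -> R,
    forall i, is_cond_expectation G \1_(X i @^-1` B i) (p i) &
    is_cond_expectation G \1_(\bigcap_(i in [set: 'I_n]) (X i @^-1` B i))
      (fun w => \prod_(i < n) p i w).

(* Given G, X is distributed as Q(D). *)
Definition cond_distributed (m : nat) (G : set (set Omega))
    (Q : R.-pker 'rV[R]_m ~> 'rV[R]_m) (D X : Omega -> 'rV[R]_m) : Prop :=
  forall B : set 'rV[R]_m, measurable B ->
    is_cond_expectation G \1_(X @^-1` B) (fun w => fine (Q (D w) B)).

Definition filtration (F : nat -> set (set Omega)) : Prop :=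
  forall k, [/\ sigma_algebra setT (F k), F k `<=` measurable
              & F k `<=` F k.+1].

(* [past k] is the information generated before iteration k; it contains the
   sigma-algebra generated by the starting points and by the g_i^j and
   Q(Delta_i^j) for j < k, and may contain further randomness of earlier
   iterations, such as sampled minibatches.  The starting points may be random
   (past 0 need not be trivial).
   [q i k] is the realization of Q(Delta_i^k), and [hbar k] stands for h^k. *)
Record diana_sgda (m n : nat) (Q : R.-pker 'rV[R]_m ~> 'rV[R]_m)
    (reg : 'rV[R]_m -> \bar R) (gamma alpha : R)
    (past : nat -> set (set Omega))
    (x : nat -> Omega -> 'rV[R]_m)
    (h g q : 'I_n -> nat -> Omega -> 'rV[R]_m)
    (hbar : nat -> Omega -> 'rV[R]_m) : Prop := DianaSgda {
  diana_filtration : filtration past ;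
  diana_x_adapted : forall k, measurable_wrt (past k) (x k) ;
  diana_h_adapted : forall i k, measurable_wrt (past k) (h i k) ;
  diana_g_adapted : forall i k, measurable_wrt (past k.+1) (g i k) ;
  diana_q_adapted : forall i k, measurable_wrt (past k.+1) (q i k) ;
  diana_hbar0 : forall w, hbar 0%N w = average (fun i => h i 0%N w) ;
  diana_h_step : forall i k w, h i k.+1 w = h i k w + alpha *: q i k w ;
  diana_hbar_step : forall k w,
    hbar k.+1 w = hbar k w + alpha *: average (fun i => q i k w) ;
  diana_x_step : forall k w,
    is_prox gamma reg
      (x k w - gamma *: (hbar k w + average (fun i => q i k w))) (x k.+1 w) ;
  diana_g_independent : forall k, cond_independent (past k) (fun i => g i k) ;
  diana_q_law : forall i k,
    cond_distributed
      <<s past k `|` \bigcup_(l in [set: 'I_n])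
            preimage_set_system setT (g l k) measurable >>
      Q (fun w => g i k w - h i k w) (q i k) ;
  diana_q_independent : forall k,
    cond_independent
      <<s past k `|` \bigcup_(l in [set: 'I_n])
            preimage_set_system setT (g l k) measurable >>
      (fun i => q i k)
}.

End conditioning.

(* Main.v *)
(* The Lyapunov function is V_k = E|x^k - xs|^2 + 4 omega gamma^2 / (alpha n)
   times the average of E|h_i^k - F_i(xs)|^2.  Since xs is a fixed point of
   prox(. - gamma F(.)), the prox step gives
     |x^(k+1) - xs| <= |a - gamma avg_i xi_i - gamma avg_i e_i|,
   where a = x^k - xs - gamma (F(x^k) - F(xs)), xi_i = g_i^k - F_i(x^k) is the
   noise of the estimates and e_i = Q(Delta_i^k) - Delta_i^k the compression
   error.  Given the past, these are orthogonal in L^2: a is known, the xi_i are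
   centered and uncorrelated, and the e_i are centered and uncorrelated given
   the xi_i.  Hence all cross terms vanish and V_(k+1) <= (1 - rho) V_k + const.
   The orthogonality relations all follow from one fact: a square integrable
   variable whose integral vanishes on every set of G is orthogonal to every
   square integrable G-measurable variable.
   When omega = 0 the shifts h_i need not be square integrable; then the
   compressor is exact almost surely and V_k does not involve them. *)
Require Import Defs.
From HB Require Import structures.
From mathcomp Require Import all_boot all_order all_algebra.
From mathcomp Require Import all_classical all_reals all_analysis.
From mathcomp Require Import measurable_realfun ring lra.
Set Implicit Arguments.
Unset Strict Implicit.
Unset Printing Implicit Defensive.
Import Order.TTheory GRing.Theory Num.Theory.
Import numFieldNormedType.Exports.
Local Open Scope classical_set_scope.
Local Open Scope ring_scope.

(** Conditional expectations are never constructed. They enter as versions supplied by the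
    hypotheses, each known only through its integrals over sets of G and unique only almost surely.
    The recursion is therefore run on full expectations, obtained from these identities on the whole
    space. Two passages carry the measure theory. Conditional independence is stated for events and
    must become zero correlation of coordinates. The conditional law of a compressed vector is also
    stated for events, and must be extended to functions before the moments of the kernel can be
    used. Square integrability has to be carried along the iterations: cocoercivity makes the
    average of |F_i(x) - F_i(xs)|^2 at most ell^2 |x - xs|^2, so square integrability of x^k - xs
    passes to the F_i(x^k) - F_i(xs), and the variance bound passes it to the estimates. It starts
    from a finite E[V_0]; if E[V_0] is infinite, there is nothing to prove. *)

Section Rintegral.
Context {d} {T : measurableType d} {R : realType}.
Variable mu : {measure set T -> \bar R}.
Implicit Types X : T -> R.

Lemma Rintegral_sum I (s : seq I) (X : I -> T -> R) :
  (forall i, mu.-integrable setT (EFin \o X i)) ->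
  \int[mu]_w (\sum_(i <- s) X i w) = \sum_(i <- s) \int[mu]_w X i w.
Proof.
move=> iX; elim: s => [|i s ih].
  by under eq_Rintegral do rewrite big_nil;
    rewrite big_nil Rintegral_cst// mul0r.
under eq_Rintegral do rewrite big_cons.
rewrite big_cons RintegralD// ?ih//.
have := integrable_sum measurableT s (P := xpredT) (fun i _ => iX i).
by apply: eq_integrable => // w _ /=; rewrite sumEFin.
Qed.

Lemma EFin_Rintegral (D : set T) X : measurable D ->
  mu.-integrable D (EFin \o X) ->
  (\int[mu]_(w in D) X w)%:E = (\int[mu]_(w in D) (X w)%:E)%E.
Proof. by move=> mD iX; rewrite /Rintegral fineK//;
  exact: integrable_fin_num. Qed.

End Rintegral.

(** * Square integrable random variables *)

Definition sqint {d} {T : measurableType d} {R : realType} (P : probability T R)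
    (X : T -> R) : Prop :=
  measurable_fun setT X /\ P.-integrable setT (fun w => (X w ^+ 2)%:E).

Section square_integrable.
Context {d} {T : measurableType d} {R : realType} (P : probability T R).
Implicit Types X Y U : T -> R.

Lemma le_sqint X Y : measurable_fun setT X -> (forall w, X w ^+ 2 <= Y w) ->
  P.-integrable setT (EFin \o Y) -> sqint P X.
Proof.
move=> mX XY iY; split => //.
apply: le_integrable iY => //.
  by apply/measurable_EFinP; exact: measurable_funX.
move=> w _ /=; rewrite lee_fin ger0_norm ?sqr_ge0//.
exact: le_trans (XY w) (ler_norm _).
Qed.

Lemma sqintM X Y : sqint P X -> sqint P Y ->
  P.-integrable setT (fun w => (X w * Y w)%:E).
Proof.
move=> [mX iX] [mY iY].
have iXY := integrableD measurableT iX iY.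
apply: le_integrable iXY => //.
  by apply/measurable_EFinP; exact: measurable_funM.
move=> w _ /=; rewrite lee_fin.
apply: le_trans (ler_norm _); rewrite ler_norml.
by apply/andP; split; nra.
Qed.

Lemma sqint_cst r : sqint P (fun=> r).
Proof.
split; first exact: measurable_cst.
by apply: finite_measure_integrable_cst.
Qed.

Lemma sqint_integrable X : sqint P X -> P.-integrable setT (EFin \o X).
Proof.
move=> X2; have := sqintM X2 (sqint_cst 1).
by under eq_fun do rewrite mulr1.
Qed.

Lemma sqintD X Y : sqint P X -> sqint P Y -> sqint P (fun w => X w + Y w).
Proof.
move=> X2 Y2; have iXY := sqintM X2 Y2.
case: X2 Y2 => [mX iX] [mY iY].
apply: (@le_sqint _ (fun w => X w ^+ 2 + Y w ^+ 2 + 2 * (X w * Y w))).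
- exact: measurable_funD.
- by move=> w; lra.
- have := integrableD measurableT (integrableD measurableT iX iY)
    (integrableZl measurableT 2 iXY).
  by apply: eq_integrable => // w _ /=; rewrite !EFinD.
Qed.

Lemma sqintZ r X : sqint P X -> sqint P (fun w => r * X w).
Proof.
move=> [mX iX]; split; first exact: measurable_funM.
have := integrableZl measurableT (r ^+ 2) iX.
by apply: eq_integrable => // w _ /=; rewrite exprMn EFinM.
Qed.

Lemma sqintN X : sqint P X -> sqint P (fun w => - X w).
Proof. by move=> /(sqintZ (-1)); under eq_fun do rewrite mulN1r. Qed.

Lemma sqintB X Y : sqint P X -> sqint P Y -> sqint P (fun w => X w - Y w).
Proof. by move=> X2 /sqintN; exact: sqintD. Qed.

Lemma sqint_sum I (s : seq I) (X : I -> T -> R) : (forall i, sqint P (X i)) ->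
  sqint P (fun w => \sum_(i <- s) X i w).
Proof.
move=> X2; elim: s => [|i s ih].
  by under eq_fun do rewrite big_nil; exact: sqint_cst.
by under eq_fun do rewrite big_cons; exact: sqintD.
Qed.

(** The bound is only almost sure because versions of conditional probabilities, and the compression
    errors for [omega = 0], are controlled only up to null sets. *)
Lemma sqint_bounded X : measurable_fun setT X ->
  {ae P, forall w, 0 <= X w <= 1} -> sqint P X.
Proof.
move=> mX X01; split => //.
apply/integrableP; split; first by apply/measurable_EFinP;
  exact: measurable_funX.
apply: (@le_lt_trans _ _ (\int[P]_w (cst 1 w))%E); last first.
  by rewrite integral_cst//= mul1e; exact: le_lt_trans (probability_le1 _ _)
    (ltry _).
apply: ae_ge0_le_integral => //.
- apply: measurableT_comp => //; apply/measurable_EFinP.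
  exact: measurable_funX.
- apply: filterS X01 => w /andP[X0 X1] _ /=.
  by rewrite lee_fin ger0_norm ?sqr_ge0// expr_le1.
Qed.

Lemma sqint_indic (A : set T) : measurable A -> sqint P \1_A.
Proof.
move=> mA; apply: sqint_bounded; first exact: measurable_indic.
by apply/aeW => w; rewrite indicE; case: (_ \in _); rewrite ?lexx ler01.
Qed.

Lemma Rintegral_ae_ge0 X : measurable_fun setT X ->
  {ae P, forall w, 0 <= X w} -> 0 <= \int[P]_w X w.
Proof.
move=> mX X0; rewrite /Rintegral (ae_eq_integral (fun w => (Num.max (X w)
  0)%:E))//.
- by apply: Rintegral_ge0 => w _; rewrite le_max lexx orbT.
- exact/measurable_EFinP.
- by apply/measurable_EFinP; exact: measurable_maxr.
- by apply: filterS X0 => w /max_idPl ->.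
Qed.

Lemma Rintegral_mul_indic U (A : set T) :
  \int[P]_w (U w * \1_A w) = \int[P]_(w in A) U w.
Proof. by rewrite [RHS]Rintegral_mkcond patch_indic. Qed.

End square_integrable.

(** * Conditional expectation *)

Section conditioning.
Import HBNNSimple.
Context {d} {T : measurableType d} {R : realType} (P : probability T R).
Implicit Types (G : set (set T)) (U X Y Z : T -> R).

Lemma measurable_wrt_sub G d' (T' : measurableType d') (X : T -> T') :
  G `<=` measurable -> measurable_wrt G X -> measurable_fun setT X.
Proof. by move=> Gm GX _ B mB; apply/Gm/GX; exists B. Qed.

Lemma sub_measurable_wrt G G' d' (T' : measurableType d') (X : T -> T') :
  G `<=` G' -> measurable_wrt G X -> measurable_wrt G' X.
Proof. by move=> GG' GX B /GX/GG'. Qed.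

Lemma measurable_wrt_comp G d' (T' : measurableType d') d'' (T'' :
  measurableType d'')
    (f : T' -> T'') (X : T -> T') :
  measurable_fun setT f -> measurable_wrt G X -> measurable_wrt G (f \o X).
Proof.
move=> mf GX _ [B mB <-]; apply: GX; exists (f @^-1` B); rewrite ?setTI//.
by rewrite -[_ @^-1` _]setTI; exact: mf.
Qed.

(** On the measurable type generated by G, a [measurable_wrt] function inherits the closure
    properties of measurable functions and their approximation by simple functions. *)
Lemma measurable_wrtP G X : sigma_algebra setT G ->
  measurable_wrt G X <->
  measurable_fun (setT : set (g_sigma_algebraType G)) X.
Proof.
move=> sG; have GE : G.-sigma.-measurable = G by exact: sigma_algebra_id.
split => [GX _ B mB|GX _ [B mB <-]].
  by rewrite GE; apply: GX; exists B.
by have := GX measurableT B mB; rewrite GE.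
Qed.

Lemma sigma_algebra_preimage_measurable d' (T' : measurableType d') (X : T ->
  T') :
  sigma_algebra setT (preimage_set_system setT X measurable).
Proof.
exact/sigma_algebra_preimage/sigma_algebra_measurable.
Qed.

(** The simple functions increasing to Y are built over G itself, so their level sets lie in G and U
    integrates to zero against each of them. Dominated convergence with bound |U Y| passes to Y. *)
Let ge0_Rintegral_mul_eq0 {G U Y} : sigma_algebra setT G -> G `<=` measurable ->
  sqint P U -> sqint P Y -> measurable_wrt G Y -> (forall w, 0 <= Y w) ->
  (forall A, G A -> \int[P]_(w in A) U w = 0) ->
  \int[P]_w (U w * Y w) = 0.
Proof.
move=> sG Gm U2 Y2 GY Y0 UG.
have GE : G.-sigma.-measurable = G by exact: sigma_algebra_id.
have /(measurable_wrtP _ sG)/measurable_EFinP mY := GY.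
pose g n : T -> R := nnsfun_approx (@measurableT _ (g_sigma_algebraType G)) mY
  n.
have g0 n w : 0 <= g n w by rewrite /g; exact: fun_ge0.
have gY w : (g n w)%:E @[n --> \oo] --> (Y w)%:E.
  by apply: (cvg_nnsfun_approx _ mY) => // z _; rewrite lee_fin.
have g_le n w : g n w <= Y w.
  rewrite /g nnsfun_approxE -lee_fin.
  by apply: (@le_approx _ _ _ setT (EFin \o Y)) => // z _; rewrite lee_fin.
have mg n : measurable_fun setT (g n).
  have : measurable_fun setT (g n : g_sigma_algebraType G -> R) by [].
  move=> /(measurable_wrtP (g n) sG); exact: measurable_wrt_sub.
have mU : measurable_fun setT U by case: U2.
have Ug0 n : (\int[P]_w (U w * g n w)%:E = 0)%E.
  have Ug2 : P.-integrable setT (fun w => (U w * g n w)%:E).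
    apply: sqintM => //; apply: (@le_sqint _ _ _ _ _ (fun w => Y w ^+ 2)) => //.
      by move=> w; rewrite ler_sqr ?nnegrE.
    by case: Y2.
  rewrite -EFin_Rintegral//; congr EFin.
  under eq_Rintegral.
    move=> w _; rewrite /g fimfunEord mulr_sumr.
    under eq_bigr do rewrite mulrCA.
    over.
  have GB (r : R) : G (g n @^-1` [set r]).
    have : measurable (g n @^-1` [set r] : set (g_sigma_algebraType G)).
      exact: measurable_sfunP.
    by rewrite GE.
  have U1 (r : R) : P.-integrable setT
      (fun w => (U w * \1_(g n @^-1` [set r]) w)%:E).
    by apply: sqintM => //; apply/sqint_indic/Gm.
  rewrite Rintegral_sum => [|i]; last exact: (integrableZl measurableT _ (U1
    _)).
  rewrite big1// => i _; rewrite RintegralZl//; last exact: U1.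
  by rewrite Rintegral_mul_indic UG ?mulr0.
have [|||||_ _] := @dominated_convergence _ _ _ P setT measurableT
  (fun n w => (U w * g n w)%:E) (fun w => (U w * Y w)%:E)
  (fun w => (`|U w * Y w|)%:E).
- by move=> k; apply/measurable_EFinP; exact: measurable_funM.
- by case/integrableP : (sqintM U2 Y2).
- apply/aeW => w _.
  by under eq_fun do rewrite EFinM; rewrite EFinM; exact: cvgeZl.
- by have := integrable_abse (sqintM U2 Y2).
- apply/aeW => w k _ /=; rewrite lee_fin !normrM ler_wpM2l//.
  by rewrite !ger0_norm.
under eq_fun do rewrite Ug0.
move=> /(@cvg_unique _ _ _ _ _ _ (cvg_cst _)) Y0E.
by rewrite /Rintegral -Y0E.
Qed.

Lemma Rintegral_mul_eq0 G U Y : sigma_algebra setT G -> G `<=` measurable ->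
  sqint P U -> sqint P Y -> measurable_wrt G Y ->
  (forall A, G A -> \int[P]_(w in A) U w = 0) ->
  \int[P]_w (U w * Y w) = 0.
Proof.
move=> sG Gm U2 Y2 GY UG.
pose p w := Num.max (Y w) 0; pose n w := Num.max (- Y w) 0.
have mY : measurable_fun setT Y by case: Y2.
have p2 : sqint P p.
  apply: (@le_sqint _ _ _ _ _ (fun w => Y w ^+ 2)); last by case: Y2.
    exact: measurable_maxr.
  by move=> w; rewrite /p; have [Y0|Y0] := leP (Y w) 0;
    rewrite ?expr0n/= ?sqr_ge0.
have n2 : sqint P n.
  apply: (@le_sqint _ _ _ _ _ (fun w => Y w ^+ 2)); last by case: Y2.
    by apply: measurable_maxr => //; exact: measurable_funN.
  by move=> w; rewrite /n; have [Y0|Y0] := leP (- Y w) 0;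
    rewrite ?sqrrN ?expr0n/= ?sqr_ge0.
have Gp : measurable_wrt G p.
  apply: (@measurable_wrt_comp _ _ _ _ _ (fun r : R => Num.max r 0)) GY.
  exact: measurable_maxr.
have Gn : measurable_wrt G n.
  apply: (@measurable_wrt_comp _ _ _ _ _ (fun r : R => Num.max (- r) 0)) GY.
  by apply: measurable_maxr => //; exact: measurable_funN.
under eq_Rintegral.
  move=> w _; have -> : U w * Y w = U w * p w - U w * n w.
    by rewrite -mulrBr /p /n; congr (_ * _); have [?|?] := leP (Y w) 0;
      have [?|?] := leP (- Y w) 0; lra.
  over.
rewrite RintegralB//; [|exact: sqintM..].
rewrite !(ge0_Rintegral_mul_eq0 sG Gm)// ?subrr// => w;
  by rewrite le_max lexx orbT.
Qed.

End conditioning.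

Section conditional_expectation.
Context {d} {T : measurableType d} {R : realType} (P : probability T R).
Implicit Types (G : set (set T)) (U X Y Z p : T -> R).

Lemma cond_expectation_Rintegral G X Z A : is_cond_expectation P G X Z -> G A ->
  \int[P]_(w in A) X w = \int[P]_(w in A) Z w.
Proof. by move=> [_ _ _ XZ] GA; rewrite /Rintegral XZ. Qed.

(** X - Z integrates to zero over every set of G, hence is orthogonal to Y. *)
Lemma cond_expectation_mul G X Z Y : sigma_algebra setT G -> G `<=` measurable
  ->
  is_cond_expectation P G X Z -> sqint P X -> sqint P Z ->
  sqint P Y -> measurable_wrt G Y ->
  \int[P]_w (X w * Y w) = \int[P]_w (Z w * Y w).
Proof.
move=> sG Gm XZ X2 Z2 Y2 GY.
have := @Rintegral_mul_eq0 _ _ _ P G (fun w => X w - Z w) Y sG Gm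
  (sqintB X2 Z2) Y2 GY.
under eq_Rintegral do rewrite mulrBl.
rewrite RintegralB//; [|exact: sqintM..] => XYZY.
apply/eqP; rewrite -subr_eq0; apply/eqP/XYZY => A GA.
rewrite RintegralB ?(cond_expectation_Rintegral XZ GA) ?subrr//.
- exact: Gm.
- by apply: integrableS (sqint_integrable X2) => //; exact: Gm.
- by apply: integrableS (sqint_integrable Z2) => //; exact: Gm.
Qed.

(** The set where Y < 0 belongs to G. The integral of Y over it is both nonpositive and nonnegative,
    so |Y| integrates to zero there. *)
Lemma ae_ge0_of_Rintegral G Y : G `<=` measurable -> measurable_wrt G Y ->
  P.-integrable setT (EFin \o Y) ->
  (forall A, G A -> 0 <= \int[P]_(w in A) Y w) -> {ae P, forall w, 0 <= Y w}.
Proof.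
move=> Gm GY iY Y0.
pose A := Y @^-1` `]-oo, 0[%classic.
have GA : G A by apply: GY; exists `]-oo, 0[%classic; rewrite ?setTI.
have mA := Gm _ GA.
have iAY : P.-integrable A (EFin \o Y) by exact: integrableS iY.
have : (\int[P]_(w in A) `|(EFin \o Y) w| = 0)%E.
  apply/eqP; rewrite eq_le integral_ge0// andbT.
  under eq_integral.
    move=> w; rewrite inE /A /= in_itv/= => Yw0.
    rewrite ltr0_norm// -mulN1r; over.
  rewrite -EFin_Rintegral//; last exact: (integrableZl mA (-1) iAY).
  by rewrite RintegralZl// lee_fin mulN1r oppr_le0 Y0.
move=> /(ae_eq_integral_abs P mA (measurable_int _ iAY)).
apply: filterS => w Aw; rewrite leNgt; apply/negP => Yw0.
have [] : (Y w)%:E = 0%E by apply: Aw; rewrite /A /= in_itv.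
by move=> Yw; rewrite Yw ltxx in Yw0.
Qed.

(** Makes every version of a conditional probability square integrable, so that it can be multiplied
    with square integrable variables. *)
Lemma cond_expectation_indic_itv G (B : set T) p : G `<=` measurable ->
  measurable B ->
  is_cond_expectation P G \1_B p -> {ae P, forall w, 0 <= p w <= 1}.
Proof.
move=> Gm mB Bp; have [i1 ip Gp _] := Bp.
have p0 : {ae P, forall w, 0 <= p w}.
  apply: (ae_ge0_of_Rintegral Gm) => // A GA.
  rewrite -(cond_expectation_Rintegral Bp GA); apply: Rintegral_ge0 => w _.
  by rewrite indicE ler0n.
have p1 : {ae P, forall w, 0 <= 1 - p w}.
  apply: (ae_ge0_of_Rintegral Gm).
  - apply: (@measurable_wrt_comp _ _ _ _ _ _ _ (fun r : R => 1 - r)) Gp.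
    exact: measurable_funB.
  - have := integrableB measurableT (sqint_integrable (sqint_cst P 1)) ip.
    by apply: eq_integrable => // w _ /=; rewrite EFinB.
  - move=> A GA; have mA := Gm _ GA.
    rewrite RintegralB//.
    + rewrite -(cond_expectation_Rintegral Bp GA) -RintegralB//.
      * by apply: Rintegral_ge0 => w _; rewrite subr_ge0 indicE;
        case: (_ \in _).
      * exact: integrableS (sqint_integrable (sqint_cst P 1)).
      * exact: integrableS i1.
    + exact: integrableS (sqint_integrable (sqint_cst P 1)).
    + exact: integrableS ip.
by apply: filterS2 p0 p1 => w -> /=; rewrite subr_ge0.
Qed.

(** Disposes of the factors of unconstrained indices in the product rule of [cond_independent]. *)
Lemma cond_expectation_indicT G p : G `<=` measurable ->
  is_cond_expectation P G \1_setT p -> {ae P, forall w, p w = 1}.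
Proof.
move=> Gm Tp; have [i1 ip Gp _] := Tp.
have p01 := cond_expectation_indic_itv Gm measurableT Tp.
have p1 : {ae P, forall w, 0 <= p w - 1}.
  apply: (ae_ge0_of_Rintegral Gm).
  - apply: (@measurable_wrt_comp _ _ _ _ _ _ _ (fun r : R => r - 1)) Gp.
    exact: measurable_funB.
  - have := integrableB measurableT ip (sqint_integrable (sqint_cst P 1)).
    by apply: eq_integrable => // w _ /=; rewrite EFinB.
  - move=> A GA; have mA := Gm _ GA.
    rewrite RintegralB//.
    + rewrite -(cond_expectation_Rintegral Tp GA) -RintegralB//.
      * by apply: Rintegral_ge0 => w _; rewrite indicT subrr.
      * exact: integrableS i1.
      * exact: integrableS (sqint_integrable (sqint_cst P 1)).
    + exact: integrableS ip.
    + exact: integrableS (sqint_integrable (sqint_cst P 1)).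
apply: filterS2 p01 p1 => w /andP[_ p1] p1'; apply/eqP.
by rewrite eq_le p1 -subr_ge0.
Qed.

End conditional_expectation.

(** * Conditional independence *)

Section conditional_independence.
Context {d} {T : measurableType d} {R : realType} (P : probability T R).
Variables (G : set (set T)).
Hypotheses (sG : sigma_algebra setT G) (Gm : G `<=` measurable).
Implicit Types X Y Z : T -> R.

(* Unconditional consequence of conditional independence given G; the versions
   p and q of the conditional probabilities may depend on both A and B. *)
Definition cond_independent2 X Y : Prop :=
  forall A B : set R, measurable A -> measurable B ->
  exists p q, [/\ is_cond_expectation P G \1_(X @^-1` A) p,
    is_cond_expectation P G \1_(Y @^-1` B) q &
    \int[P]_w \1_(X @^-1` A `&` Y @^-1` B) w = \int[P]_w (p w * q w)].

(* With Q a version of P(Y \in B | G), the variable 1_B(Y) - Q is orthogonal to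
   every 1_A(X), hence to X; so X - E[X|G] is orthogonal to every 1_B(Y), hence
   to Y. *)
Lemma cond_independent2_uncorrelated X Y ZX ZY :
  cond_independent2 X Y -> sqint P X -> sqint P Y -> sqint P ZX -> sqint P ZY ->
  is_cond_expectation P G X ZX -> is_cond_expectation P G Y ZY ->
  \int[P]_w ((X w - ZX w) * (Y w - ZY w)) = 0.
Proof.
move=> indXY X2 Y2 ZX2 ZY2 XZX YZY.
have mX : measurable_fun setT X by case: X2.
have mY : measurable_fun setT Y by case: Y2.
have mXA A : measurable A -> measurable (X @^-1` A).
  by move=> mA; rewrite -[_ @^-1` _]setTI; exact: mX.
have mYB B : measurable B -> measurable (Y @^-1` B).
  by move=> mB; rewrite -[_ @^-1` _]setTI; exact: mY.
have c2 (E : set T) p : measurable E -> is_cond_expectation P G \1_E p ->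
    sqint P p /\ measurable_wrt G p.
  move=> mE Ep; have [_ _ Gp _] := Ep; split=> //.
  apply: sqint_bounded; last exact: cond_expectation_indic_itv Ep.
  exact: measurable_wrt_sub Gp.
have XB B : measurable B ->
    \int[P]_w ((X w - ZX w) * \1_(Y @^-1` B) w) = 0.
  move=> mB; have B2 := sqint_indic P (mYB _ mB).
  (* The version q of P(Y in B | G) is fixed here, from the instance A = setT, because it must not
     depend on the sets A tested below. *)
  have [_ [q [_ Bq _]]] := indXY setT B measurableT mB.
  have [q2 Gq] := c2 _ _ (mYB _ mB) Bq.
  have qX : \int[P]_w ((\1_(Y @^-1` B) w - q w) * X w) = 0.
    apply: (@Rintegral_mul_eq0 _ _ _ P (preimage_set_system setT X measurable))
      => //.
    - exact: sigma_algebra_preimage_measurable.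
    - by move=> _ [A mA <-]; exact: mX.
    - exact: sqintB.
    - move=> _ [A mA <-]; rewrite setTI -Rintegral_mul_indic.
      have [p [q' [Ap Bq' pq']]] := indXY A B mA mB.
      have A2 := sqint_indic P (mXA _ mA).
      have [p2 Gp] := c2 _ _ (mXA _ mA) Ap.
      have [q'2 Gq'] := c2 _ _ (mYB _ mB) Bq'.
      under eq_Rintegral do rewrite mulrBl.
      rewrite RintegralB//; [|exact: sqintM..].
      apply/eqP; rewrite subr_eq0; apply/eqP.
      transitivity (\int[P]_w (p w * q' w)).
        by rewrite -pq'; under eq_Rintegral do rewrite mulrC -[_ * _]/((\1__ \*
          \1__) _) -indicI.
      (* The integrals of p q', 1_B p, q p and 1_A q agree in turn: the version q' tied to A is
         traded for the fixed q by passing through 1_B. *)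
      under eq_Rintegral do rewrite mulrC.
      rewrite -(cond_expectation_mul sG Gm Bq' B2 q'2 p2 Gp).
      rewrite (cond_expectation_mul sG Gm Bq B2 q2 p2 Gp).
      under eq_Rintegral do rewrite mulrC.
      rewrite -(cond_expectation_mul sG Gm Ap A2 p2 q2 Gq).
      by under eq_Rintegral do rewrite mulrC.
  (* The integrals of X 1_B, X q, ZX q and ZX 1_B agree in turn: the first equality is [qX], the
     others hold because ZX and q are the conditional expectations of X and 1_B. *)
  have GZX : measurable_wrt G ZX by case: XZX.
  move: qX; under eq_Rintegral do rewrite mulrBl.
  rewrite RintegralB//; [|exact: sqintM..].
  move=> /eqP; rewrite subr_eq0 => /eqP BX.
  under eq_Rintegral do rewrite mulrBl.
  rewrite RintegralB//; [|exact: sqintM..].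
  apply/eqP; rewrite subr_eq0; apply/eqP.
  under eq_Rintegral do rewrite mulrC.
  rewrite BX; under eq_Rintegral do rewrite mulrC.
  rewrite (cond_expectation_mul sG Gm XZX X2 ZX2 q2 Gq).
  under eq_Rintegral do rewrite mulrC.
  rewrite -(cond_expectation_mul sG Gm Bq B2 q2 ZX2 GZX).
  by under eq_Rintegral do rewrite mulrC.
have XY0 : \int[P]_w ((X w - ZX w) * Y w) = 0.
  apply: (@Rintegral_mul_eq0 _ _ _ P (preimage_set_system setT Y measurable))
    => //.
  - exact: sigma_algebra_preimage_measurable.
  - by move=> _ [A mA <-]; exact: mY.
  - exact: sqintB.
  - by move=> _ [B mB <-]; rewrite setTI -Rintegral_mul_indic XB.
have XZ0 : \int[P]_w ((X w - ZX w) * ZY w) = 0.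
  have GZY : measurable_wrt G ZY by case: YZY.
  under eq_Rintegral do rewrite mulrBl.
  rewrite RintegralB//; [|exact: sqintM..].
  by rewrite (cond_expectation_mul sG Gm XZX X2 ZX2 ZY2 GZY) subrr.
under eq_Rintegral do rewrite mulrBr.
rewrite RintegralB//; [|by apply: sqintM => //; exact: sqintB..].
by rewrite XY0 XZ0 subrr.
Qed.

Lemma measurable_coord m (j : 'I_m) :
  measurable_fun setT (fun u : 'rV[R]_m => u 0 j).
Proof.
move=> _ B mB; apply: sub_sigma_algebra.
by exists (0, j) => //; exists B.
Qed.

Lemma measurable_coord_set m (j : 'I_m) (B : set R) :
  measurable B -> measurable [set u : 'rV[R]_m | B (u 0 j)].
Proof. by move=> mB; have := measurable_coord j measurableT mB;
  rewrite setTI. Qed.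

(** The test sets constrain coordinate k of the two chosen vectors and leave the others free; the
    free factors are almost surely 1. A common k suffices because a dot product pairs equal
    coordinates. Integrating over the whole space removes the conditioning. *)
Lemma cond_independent_coord (n m : nat) (X : 'I_n -> T -> 'rV[R]_m)
    (i j : 'I_n) (k : 'I_m) : i != j ->
  (forall i, measurable_fun setT (X i)) ->
  cond_independent P G X ->
  cond_independent2 (fun w => X i w 0 k) (fun w => X j w 0 k).
Proof.
move=> ij mX indX A B mA mB.
pose C l := if l == i then [set u : 'rV[R]_m | A (u 0 k)] else
  if l == j then [set u : 'rV[R]_m | B (u 0 k)] else setT.
have mC l : measurable (C l).
  by rewrite /C; case: eqP => _; [|case: eqP => _//];
    exact: measurable_coord_set.
have [p Xp Xprod] := indX C mC.
have Ci : C i = [set u : 'rV[R]_m | A (u 0 k)] by rewrite /C eqxx.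
have Cj : C j = [set u : 'rV[R]_m | B (u 0 k)] by rewrite /C eqxx eq_sym
  (negbTE ij).
exists (p i), (p j); split.
- by have := Xp i; rewrite Ci.
- by have := Xp j; rewrite Cj.
have -> : (fun w => X i w 0 k) @^-1` A `&` (fun w => X j w 0 k) @^-1` B =
    \bigcap_(l in [set: 'I_n]) (X l @^-1` C l).
  apply/seteqP; split => w /=.
    move=> [Aw Bw] l _ /=; rewrite /C; case: eqP => [->//|_].
    by case: eqP => [->//|_].
  by move=> Cw; split; [have := Cw i I | have := Cw j I]; rewrite /= ?Ci ?Cj.
have /= := Xprod; case=> _ iprod _ XE.
have sgT : G setT by case: sG => G0 GC _; rewrite -[setT]setD0; exact: GC.
rewrite /Rintegral (XE _ sgT); congr fine.
have c01 l : {ae P, forall w, l != i -> l != j -> p l w = 1}.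
  have [li|li] := eqVneq l i; first by apply/aeW.
  have [lj|lj] := eqVneq l j; first by apply/aeW.
  have := Xp l; rewrite /C (negbTE li) (negbTE lj) preimage_setT.
  move=> /(cond_expectation_indicT Gm); exact: filterS.
apply: ae_eq_integral => //.
- exact: measurable_int iprod.
- apply/measurable_EFinP/measurable_funM; apply/measurable_EFinP.
    by case: (Xp i) => _ /measurable_int.
  by case: (Xp j) => _ /measurable_int.
have : {ae P, forall w, forall l, l != i -> l != j -> p l w = 1}.
  exact: filter_forall.
apply: filterS => w pw _; rewrite (bigD1 i)//= (bigD1 j) 1?eq_sym//=.
rewrite big1 ?mulr1// => l /andP[li lj]; exact: pw.
Qed.

End conditional_independence.

(** * Compressed vectors *)

Section regular_conditional_law.
Import HBNNSimple.
Context {d} {T : measurableType d} {R : realType} (P : probability T R).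
Variables (G : set (set T)) (m : nat) (Q : R.-pker 'rV[R]_m ~> 'rV[R]_m).
Hypothesis Gm : G `<=` measurable.
Variables (D X : T -> 'rV[R]_m).
Hypotheses (GD : measurable_wrt G D) (mX : measurable_fun setT X).
Hypothesis XQ : cond_distributed P G Q D X.

Let mD : measurable_fun setT D.
Proof. exact: measurable_wrt_sub GD. Qed.

Let mQ B : measurable B -> measurable_fun setT (fun w => Q (D w) B).
Proof. by move=> mB; exact: measurableT_comp (measurable_kernel Q B mB) mD. Qed.

Let Qfin w B : measurable B -> Q (D w) B = (fine (Q (D w) B))%:E.
Proof. by move=> mB; rewrite fineK//; exact: finite_kernel_measure. Qed.

Let cond_distributed_nnsfun (f : {nnsfun 'rV[R]_m >-> R}) A : G A ->
  (\int[P]_(w in A) (f (X w))%:E =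
   \int[P]_(w in A) \int[Q (D w)]_y (f y)%:E)%E.
Proof.
move=> GA; have mA := Gm GA.
under [in RHS]eq_integral.
  move=> w _.
  under eq_integral do rewrite fimfunE -fsumEFin//.
  rewrite /= ge0_integral_fsum//; last 2 first.
    - by move=> r; exact/measurable_EFinP/measurableT_comp.
    - by move=> r z _; rewrite EFinM nnfun_muleindic_ge0.
  under eq_fsbigr.
    move=> r _.
    rewrite (integralZl_indic _ (fun r => f @^-1` [set r]))//; last first.
      by move=> r0; rewrite preimage_nnfun0.
    rewrite integral_indic// setIT.
    over.
  over.
under [in LHS]eq_integral do rewrite fimfunE -fsumEFin//.
rewrite /= ge0_integral_fsum//; last 2 first.
- move=> r; apply/measurable_EFinP; apply: measurable_funTS.
  apply: measurable_funM => //.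
  by apply: measurableT_comp mX; apply: measurable_indic.
- by move=> r w _; rewrite EFinM nnfun_muleindic_ge0.
rewrite ge0_integral_fsum//; last 2 first.
- by move=> r; apply: measurable_funeM; apply: measurable_funTS; exact: mQ.
- move=> r w _.
  have := mulemu_ge0 (fun n => f @^-1` [set n]).
  by apply; exact: preimage_nnfun0.
apply: eq_fsbigr => r _.
have [_ _ _ /(_ _ GA) XE] := XQ (measurable_sfunP f (measurable_set1 r)).
(* For r < 0 the level set of the nonnegative f is empty and both sides vanish; for r >= 0 the
   scalar can be pulled out of the integral. *)
have [r0|r0] := leP 0 r; last first.
  rewrite !integral0_eq// => w _.
    by rewrite preimage_nnfun0// measure0 mule0.
  by rewrite preimage_nnfun0// indic0 mulr0.
rewrite ge0_integralZl//; last by apply: measurable_funTS; exact: mQ.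
under [in RHS]eq_integral do rewrite Qfin//.
rewrite -XE -ge0_integralZl//.
apply/measurable_EFinP/measurable_indic.
by rewrite -[X in measurable X]setTI; exact: mX.
Qed.

(** Linearity extends the law from events to simple functions; monotone convergence, under P on both
    sides and inside the kernel on the right, extends it to nonnegative functions. *)
Lemma ge0_integral_cond_distributed (f : 'rV[R]_m -> R) A :
  measurable_fun setT f -> (forall y, 0 <= f y) -> G A ->
  (\int[P]_(w in A) (f (X w))%:E =
   \int[P]_(w in A) \int[Q (D w)]_y (f y)%:E)%E.
Proof.
move=> mf f0 GA; have mA := Gm GA.
have mEf : measurable_fun setT (EFin \o f) by exact/measurable_EFinP.
have Ef0 y : setT y -> (0 <= (EFin \o f) y)%E by rewrite lee_fin.
pose g := nnsfun_approx measurableT mEf.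
have gf y : (EFin \o g ^~ y) n @[n --> \oo] --> (f y)%:E.
  exact: (cvg_nnsfun_approx measurableT mEf Ef0).
have mgX n : measurable_fun A (fun w => (g n (X w))%:E).
  by apply/measurable_EFinP; apply: measurable_funTS; exact: measurableT_comp.
have mgQ n : measurable_fun A (fun w => \int[Q (D w)]_y (g n y)%:E)%E.
  apply: measurable_funTS; apply: measurable_fun_integral_kernel => //.
    by move=> y; rewrite lee_fin.
  exact/measurable_EFinP.
have ndg y : {homo (fun n => (g n y)%:E) : a b / (a <= b)%N >-> (a <= b)%E}.
  by move=> a b ab; rewrite lee_fin; exact/lefP/nd_nnsfun_approx.
transitivity (\int[P]_(w in A) limn (fun n => (g n (X w))%:E))%E.
  by apply: eq_integral => w _; apply/esym/cvg_lim => //; exact: gf.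
rewrite monotone_convergence//; last first.
  by move=> n w _; rewrite lee_fin.
under eq_fun do rewrite cond_distributed_nnsfun//.
rewrite -monotone_convergence//; last 2 first.
- by move=> n w _; apply: integral_ge0 => y _; rewrite lee_fin.
- move=> w _ a b ab; apply: ge0_le_integral => //.
  + by move=> z _; rewrite lee_fin.
  + exact/measurable_EFinP.
  + exact/measurable_EFinP.
  + by move=> z _; exact: ndg.
apply: eq_integral => w _; rewrite -monotone_convergence//.
- by apply: eq_integral => y _; apply/cvg_lim => //; exact: gf.
- by move=> n; exact/measurable_EFinP.
- by move=> n y _; rewrite lee_fin.
Qed.

End regular_conditional_law.

Section euclidean.
Context {R : realType} {m : nat}.
Implicit Types u v w : 'rV[R]_m.

Lemma dotvC u v : dotv u v = dotv v u.
Proof. by apply: eq_bigr => j _; rewrite mulrC. Qed.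

Lemma dotvDl u v w : dotv (u + v) w = dotv u w + dotv v w.
Proof. by rewrite -big_split; apply: eq_bigr => j _; rewrite mxE mulrDl. Qed.

Lemma dotvZl r u v : dotv (r *: u) v = r * dotv u v.
Proof. by rewrite mulr_sumr; apply: eq_bigr => j _; rewrite mxE mulrA. Qed.

Lemma dotvNl u v : dotv (- u) v = - dotv u v.
Proof. by rewrite -scaleN1r dotvZl mulN1r. Qed.

Lemma dotvDr u v w : dotv u (v + w) = dotv u v + dotv u w.
Proof. by rewrite dotvC dotvDl !(dotvC u). Qed.

Lemma dotvZr r u v : dotv u (r *: v) = r * dotv u v.
Proof. by rewrite dotvC dotvZl dotvC. Qed.

Lemma dotvNr u v : dotv u (- v) = - dotv u v.
Proof. by rewrite dotvC dotvNl dotvC. Qed.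

Lemma dotv_suml (I : finType) (u : I -> 'rV[R]_m) v :
  dotv (\sum_i u i) v = \sum_i dotv (u i) v.
Proof.
apply: (big_morph (fun u => dotv u v)) => [u1 u2|]; first exact: dotvDl.
by rewrite -(scale0r 0) dotvZl mul0r.
Qed.

Definition dotvE := (dotvDl, dotvDr, dotvNl, dotvNr, dotvZl, dotvZr).

Lemma dotv_ge0 u : 0 <= dotv u u.
Proof. by apply: sumr_ge0 => j _; rewrite -expr2 sqr_ge0. Qed.

Lemma enorm_sqr u : enorm u ^+ 2 = dotv u u.
Proof. by rewrite sqr_sqrtr// dotv_ge0. Qed.

Lemma coord_sqr_le_dotv u (j : 'I_m) : u 0 j ^+ 2 <= dotv u u.
Proof.
rewrite /dotv (bigD1 j)//= -expr2 lerDl.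
by apply: sumr_ge0 => k _; rewrite -expr2 sqr_ge0.
Qed.

Lemma measurable_dotv d (T : measurableType d) (u v : T -> 'rV[R]_m) :
  measurable_fun setT u -> measurable_fun setT v ->
  measurable_fun setT (fun t => dotv (u t) (v t)).
Proof.
move=> mu mv; apply: measurable_sum => j.
apply: measurable_funM.
  exact: (measurableT_comp (measurable_coord j) mu).
exact: (measurableT_comp (measurable_coord j) mv).
Qed.

End euclidean.

(** * Moments of the compressor at a fixed input *)

Section compressor.
Context {R : realType} {m : nat} (omega : R) (Q : R.-pker 'rV[R]_m ~> 'rV[R]_m).
Hypothesis Q_compressor : unbiased_compressor omega Q.

Lemma measurable_subr_mx (x : 'rV[R]_m) :
  measurable_fun setT (fun y : 'rV[R]_m => dotv (y - x) (y - x)).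
Proof.
apply: measurable_sum => j; apply: measurable_funM;
  under eq_fun do rewrite mxE; apply: measurable_funD => //;
    exact: measurable_coord.
Qed.

Lemma compressor_integrable (x : 'rV[R]_m) :
  (Q x).-integrable setT (fun y => (dotv (y - x) (y - x))%:E).
Proof.
have [_ Qx] := Q_compressor x.
apply/integrableP; split; first by apply/measurable_EFinP;
  exact: measurable_subr_mx.
apply: le_lt_trans (ltry (omega * enorm x ^+ 2)); apply: le_trans Qx.
apply: ge0_le_integral => //.
- by apply: measurableT_comp => //; apply/measurable_EFinP;
  exact: measurable_subr_mx.
- apply/measurable_EFinP; under eq_fun do rewrite enorm_sqr.
  exact: measurable_subr_mx.
- by move=> y _ /=; rewrite lee_fin enorm_sqr ger0_norm// dotv_ge0.
Qed.

Lemma compressor_second_moment (x : 'rV[R]_m) :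
  (\int[Q x]_y (dotv y y)%:E <= ((1 + omega) * dotv x x)%:E)%E.
Proof.
have [Qj Qx] := Q_compressor x.
have iy j : (Q x).-integrable setT (fun y : 'rV[R]_m => (x 0 j * y 0 j)%:E).
  exact: (integrableZl measurableT (x 0 j) (Qj j).1).
have iL : (Q x).-integrable setT (fun y : 'rV[R]_m => (dotv x y)%:E).
  have := integrable_sum measurableT (index_enum 'I_m) (P := xpredT)
    (fun j _ => iy j).
  by apply: eq_integrable => // y _ /=; rewrite sumEFin.
have EL : \int[Q x]_y dotv x y = dotv x x.
  rewrite Rintegral_sum//; apply: eq_bigr => j _.
  have [ij Ej] := Qj j; rewrite RintegralZl//; congr (_ * _).
  by rewrite /Rintegral Ej.
have fQ : Q x setT = 1%E by exact: prob_kernel.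
have i1 : (Q x).-integrable setT (fun=> (dotv x x)%:E).
  apply/integrableP; split=> //.
  by rewrite integral_cst// fQ mule1 ltry.
have iD := compressor_integrable x.
have i2 : (Q x).-integrable setT
    (fun y : 'rV[R]_m => (dotv (y - x) (y - x) + 2 * dotv x y)%:E).
  have := integrableD measurableT iD (integrableZl measurableT 2 iL).
  by apply: eq_integrable.
(* Expansion around x: the terms on the right are already known to be integrable, so the
   integrability of |y|^2 comes together with its integral. *)
have -> : (fun y : 'rV[R]_m => (dotv y y)%:E) =
    (fun y => (dotv (y - x) (y - x) + 2 * dotv x y - dotv x x)%:E).
  by apply/funext => y; rewrite !dotvE (dotvC y x); congr EFin; ring.
rewrite -EFin_Rintegral//; last first.
  by have := integrableB measurableT i2 i1; apply: eq_integrable.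
rewrite RintegralB// RintegralD//; last exact: (integrableZl measurableT 2 iL).
rewrite RintegralZl// EL Rintegral_cst// fQ mulr1 lee_fin.
have : \int[Q x]_y dotv (y - x) (y - x) <= omega * dotv x x.
  rewrite -lee_fin EFin_Rintegral// -enorm_sqr.
  by under eq_integral do rewrite -enorm_sqr.
lra.
Qed.

(** For [omega = 0] the variance bound concentrates [Q x] at x. [compressed_exact] uses this through
    null sets of single coordinates. *)
Lemma compressor_coord_neq0 (x : 'rV[R]_m) (B : set R) (j : 'I_m) : omega = 0 ->
  measurable B -> ~ B (x 0 j) -> Q x [set y : 'rV[R]_m | B (y 0 j)] = 0%E.
Proof.
move=> omega0 mB Bx; have [_ Qx] := Q_compressor x.
have mC := measurable_coord_set j mB.
have : (\int[Q x]_y `|(dotv (y - x) (y - x))%:E| = 0)%E.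
  apply/eqP; rewrite eq_le integral_ge0// andbT.
  move: Qx; rewrite omega0 mul0r; apply: le_trans.
  rewrite le_eqVlt; apply/orP; left; apply/eqP/eq_integral => y _.
  by rewrite enorm_sqr gee0_abs// lee_fin dotv_ge0.
move=> /(ae_eq_integral_abs _ measurableT).
move=> /(_ (measurable_int _ (compressor_integrable x))) ae0.
apply/negligibleP => //; apply: negligibleS ae0 => y /= By.
move=> /(_ I) [yx0]; apply: Bx; suff <- : y 0 j = x 0 j by [].
have := coord_sqr_le_dotv (y - x) j; rewrite yx0 !mxE => yx.
by apply/eqP; rewrite -subr_eq0 -sqrf_eq0 eq_le yx sqr_ge0.
Qed.

End compressor.

(** * Compression of a random input *)

Section compressed_law.
Context {d} {T : measurableType d} {R : realType} (P : probability T R).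
Variables (G : set (set T)) (m : nat) (omega : R).
Variable (Q : R.-pker 'rV[R]_m ~> 'rV[R]_m).
Hypotheses (sG : sigma_algebra setT G) (Gm : G `<=` measurable).
Hypothesis omega_ge0 : 0 <= omega.
Hypothesis Q_compressor : unbiased_compressor omega Q.
Variables (D X : T -> 'rV[R]_m).
Hypotheses (GD : measurable_wrt G D) (mX : measurable_fun setT X).
Hypothesis XQ : cond_distributed P G Q D X.

Let mD : measurable_fun setT D.
Proof. exact: measurable_wrt_sub GD. Qed.

Let GT : G setT.
Proof. by case: sG => G0 GC _; rewrite -[setT]setD0; exact: GC. Qed.

Let mXj j : measurable_fun setT (fun w => X w 0 j).
Proof. exact: (measurableT_comp (measurable_coord j) mX). Qed.

Section square_integrable_input.
Hypothesis D2 : forall j, sqint P (fun w => D w 0 j).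

Let iDD : P.-integrable setT (fun w => (dotv (D w) (D w))%:E).
Proof.
have := integrable_sum measurableT (index_enum 'I_m) (P := xpredT)
  (fun j _ => sqintM (D2 j) (D2 j)).
by apply: eq_integrable => // w _ /=; rewrite sumEFin.
Qed.

Lemma compressed_second_moment :
  (\int[P]_w (dotv (X w) (X w))%:E <=
   ((1 + omega) * \int[P]_w dotv (D w) (D w))%:E)%E.
Proof.
rewrite (ge0_integral_cond_distributed Gm GD mX XQ (f := fun y => dotv y y))//;
  last 2 first.
- exact: measurable_dotv.
- by move=> y; exact: dotv_ge0.
rewrite EFinM EFin_Rintegral// -ge0_integralZl//; last 3 first.
- by apply/measurable_EFinP; exact: measurable_dotv.
- by move=> w _; rewrite lee_fin dotv_ge0.
- by rewrite lee_fin addr_ge0.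
apply: ge0_le_integral => //.
- by move=> w _; apply: integral_ge0 => y _; rewrite lee_fin dotv_ge0.
- have mk : measurable_fun setT (fun x => \int[Q x]_y (dotv y y)%:E)%E.
    apply: measurable_fun_integral_kernel => //.
    + exact: measurable_kernel.
    + by move=> y; rewrite lee_fin dotv_ge0.
    + by apply/measurable_EFinP; exact: measurable_dotv.
  exact: (measurableT_comp mk mD).
- by apply: measurable_funeM; apply/measurable_EFinP; exact: measurable_dotv.
- by move=> w _; rewrite -EFinM; exact: compressor_second_moment.
Qed.

Lemma sqint_compressed j : sqint P (fun w => X w 0 j).
Proof.
apply: (@le_sqint _ _ _ _ _ (fun w => dotv (X w) (X w))) => //.
  by move=> w; exact: coord_sqr_le_dotv.
apply/integrableP; split; first by apply/measurable_EFinP;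
  exact: measurable_dotv.
apply: le_lt_trans (ltry ((1 + omega) * \int[P]_w dotv (D w) (D w))).
apply: le_trans compressed_second_moment.
by under eq_integral do rewrite /= ger0_norm ?dotv_ge0//.
Qed.

(** The transfer to the kernel covers nonnegative functions only, so the coordinate is split into
    positive and negative parts; the second moment of X makes both integrals finite. *)
Lemma compressed_cond_expectation j :
  is_cond_expectation P G (fun w => X w 0 j) (fun w => D w 0 j).
Proof.
have iX := sqint_integrable (sqint_compressed j).
have iD := sqint_integrable (D2 j).
split=> //.
  exact: (measurable_wrt_comp (measurable_coord j) GD).
move=> A GA; have mA := Gm GA.
have split_int (f : 'rV[R]_m -> R) : measurable_fun setT f ->
    (forall y, 0 <= f y) -> P.-integrable setT (fun w => (f (X w))%:E) ->
    (\int[P]_(w in A) (f (X w))%:E = \int[P]_(w in A) \int[Q (D w)]_y (f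
      y)%:E)%E /\
    P.-integrable setT (fun w => \int[Q (D w)]_y (f y)%:E)%E.
  move=> mf f0 ifX; split.
    exact: (ge0_integral_cond_distributed Gm GD mX XQ).
  apply/integrableP; split.
    have mk : measurable_fun setT (fun x => \int[Q x]_y (f y)%:E)%E.
      apply: measurable_fun_integral_kernel => //.
        exact: measurable_kernel.
      exact/measurable_EFinP.
    exact: (measurableT_comp mk mD).
  under eq_integral.
    move=> w _; rewrite gee0_abs; last first.
      by apply: integral_ge0 => y _; rewrite lee_fin.
    over.
  rewrite -(ge0_integral_cond_distributed Gm GD mX XQ)//.
  exact: integrable_lty.
pose p (y : 'rV[R]_m) := Num.max (y 0 j) 0.
pose n (y : 'rV[R]_m) : R := Num.max (- y 0 j) 0.
have mp : measurable_fun setT p.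
  by apply: measurable_maxr => //; exact: measurable_coord.
have mn : measurable_fun setT n.
  by apply: measurable_maxr => //; apply: measurable_funN;
    exact: measurable_coord.
have p0 y : 0 <= p y by rewrite /p le_max lexx orbT.
have n0 y : 0 <= n y by rewrite /n le_max lexx orbT.
have pn (y : 'rV[R]_m) : y 0 j = p y - n y.
  by rewrite /p /n; have [?|?] := leP (y 0 j) 0;
    have [?|?] := leP (- y 0 j) 0; lra.
have ip : P.-integrable setT (fun w => (p (X w))%:E).
  exact: (integrable_funrpos measurableT iX).
have im : P.-integrable setT (fun w => (n (X w))%:E).
  exact: (integrable_funrneg measurableT iX).
have [Ep ikp] := split_int _ mp p0 ip.
have [En ikn] := split_int _ mn n0 im.
under eq_integral do rewrite pn EFinB.
rewrite integralB//; [|exact: integrableS ip|exact: integrableS im].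
rewrite Ep En -integralB//; [|exact: integrableS ikp|exact: integrableS ikn].
apply: eq_integral => w _.
have [Qj _] := Q_compressor (D w); have [ij Ej] := Qj j.
rewrite -Ej [RHS](eq_integral (fun y => (p y)%:E - (n y)%:E)%E); last first.
  by move=> y _; rewrite -EFinB -pn.
rewrite integralB//.
- exact: (integrable_funrpos measurableT ij).
- exact: (integrable_funrneg measurableT ij).
Qed.

End square_integrable_input.

(** D may fail to be square integrable here, so equality is tested on events: for each coordinate
    and each rational c, it is a null event that X lies strictly on one side of c and D does not. A
    rational separates any two distinct reals. *)
Lemma compressed_exact : omega = 0 -> {ae P, forall w, X w = D w}.
Proof.
move=> omega0.
have ae_B j (B : set R) : measurable B ->
    {ae P, forall w, ~ (~ B (D w 0 j) /\ B (X w 0 j))}.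
  move=> mB.
  pose A := [set w | ~ B (D w 0 j)].
  have GA : G A.
    apply: GD; exists [set y : 'rV[R]_m | (~` B) (y 0 j)];
      last by rewrite setTI.
    by apply: measurable_coord_set; exact: measurableC.
  have mXB : measurable (X @^-1` [set y : 'rV[R]_m | B (y 0 j)]).
    by rewrite -[X in measurable X]setTI; apply: mX => //;
      exact: measurable_coord_set.
  have [_ _ _ /(_ _ GA)] := XQ (measurable_coord_set j mB).
  rewrite integral_indic//; last exact: Gm.
  rewrite [RHS]integral0_eq => [XB0|w Aw]; last first.
    by rewrite (compressor_coord_neq0 Q_compressor omega0 mB Aw).
  exists (A `&` X @^-1` [set y : 'rV[R]_m | B (y 0 j)]); split.
  - by apply: measurableI => //; exact: Gm.
  - by rewrite setIC.
  - by move=> w /contrapT [].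
(* [unpickle] enumerates the pairs of a coordinate and a rational, so one null set serves them all;
   a code of no pair imposes nothing. *)
have ae_q : {ae P, forall w, forall k, forall j (c : rat), unpickle k = Some
  (j, c) ->
    ~ (~ (ratr c < D w 0 j) /\ ratr c < X w 0 j) /\
    ~ (~ (D w 0 j < ratr c) /\ X w 0 j < ratr c)}.
  apply/ae_foralln => k.
  case: (unpickle k : option ('I_m * rat)) => [[j c]|]; last by apply/aeW.
  have a1 := ae_B j _ (measurable_itv `]ratr c, +oo[).
  have a2 := ae_B j _ (measurable_itv `]-oo, ratr c[).
  apply: filterS2 a1 a2 => w /= + + j' c' [<- <-].
  by rewrite !in_itv /= !andbT.
apply: filterS ae_q => w wq; apply/rowP => j; apply/eqP; rewrite eq_le.
apply/andP; split; rewrite leNgt; apply/negP => ltDX.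
  have [c] := rat_in_itvoo ltDX; rewrite in_itv /= => /andP[Dc cX].
  have [+ _] := wq (pickle (j, c)) j c (pickleK _); apply; split=> //.
  by apply/negP; rewrite -leNgt ltW.
have [c] := rat_in_itvoo ltDX; rewrite in_itv /= => /andP[Xc cD].
have [_] := wq (pickle (j, c)) j c (pickleK _); apply; split=> //.
by apply/negP; rewrite -leNgt ltW.
Qed.

End compressed_law.

(** * Square integrable random vectors *)

Definition sqint_rV {d} {T : measurableType d} {R : realType}
    (P : probability T R) m (u : T -> 'rV[R]_m) : Prop :=
  forall j, sqint P (fun w => u w 0 j).

(** The inner product of square integrable random vectors. [Rintegral] is real valued: an infinite
    integral is read as 0. *)
Definition edot {d} {T : measurableType d} {R : realType}
    (P : probability T R) m (u v : T -> 'rV[R]_m) : R :=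
  \int[P]_w dotv (u w) (v w).

(** Coordinatewise, the form in which [is_cond_expectation_rV] delivers measurability. *)
Definition measurable_wrt_rV {d} {T : measurableType d} {R : realType} m
    (G : set (set T)) (u : T -> 'rV[R]_m) : Prop :=
  forall j, measurable_wrt G (fun w => u w 0 j).

Section measurable_wrt_rV.
Context {d} {T : measurableType d} {R : realType} {m : nat}.
Variable G : set (set T).
Hypothesis sG : sigma_algebra setT G.
Implicit Types u v : T -> 'rV[R]_m.

(** The sets whose preimage lies in G form a sigma-algebra containing the coordinate cylinders,
    which generate the measurable sets of row vectors. *)
Lemma measurable_wrt_rVP u : measurable_wrt_rV G u <-> measurable_wrt G u.
Proof.
split => [Gu _ [B mB <-]|Gu j]; last first.
  exact: (measurable_wrt_comp (measurable_coord j) Gu).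
rewrite setTI; suff sub : measurable `<=` [set B | G (u @^-1` B)] by exact: sub.
apply: smallest_sub => [|C [[i j] _ [B' mB' <-]]].
  case: sG => G0 GC GU; split => [|A GA|A GA] /=.
  - by rewrite preimage_set0.
  - by have := GC _ GA; rewrite !setTD preimage_setC.
  - by rewrite preimage_bigcup; exact: GU.
by apply: (Gu j); exists B' => //; rewrite !setTI (ord1 i).
Qed.

Lemma measurable_wrt_rV_cst (c : 'rV[R]_m) : measurable_wrt_rV G (fun=> c).
Proof. by move=> j; apply/(measurable_wrtP _ sG). Qed.

Lemma measurable_wrt_rVD u v : measurable_wrt_rV G u -> measurable_wrt_rV G v ->
  measurable_wrt_rV G (fun w => u w + v w).
Proof.
move=> Gu Gv j; under eq_fun do rewrite mxE.
apply/(measurable_wrtP _ sG)/measurable_funD; apply/(measurable_wrtP _ sG).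
  exact: Gu.
exact: Gv.
Qed.

Lemma measurable_wrt_rVZ r u : measurable_wrt_rV G u ->
  measurable_wrt_rV G (fun w => r *: u w).
Proof.
move=> Gu j; under eq_fun do rewrite mxE.
apply/(measurable_wrtP _ sG)/measurable_funM => //;
  apply/(measurable_wrtP _ sG).
exact: Gu.
Qed.

Lemma measurable_wrt_rVB u v : measurable_wrt_rV G u -> measurable_wrt_rV G v ->
  measurable_wrt_rV G (fun w => u w - v w).
Proof.
move=> Gu Gv; apply: measurable_wrt_rVD => //.
by under eq_fun do rewrite -scaleN1r; exact: measurable_wrt_rVZ.
Qed.

Lemma measurable_wrt_rV_sum I (s : seq I) (u : I -> T -> 'rV[R]_m) :
  (forall i, measurable_wrt_rV G (u i)) ->
  measurable_wrt_rV G (fun w => \sum_(i <- s) u i w).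
Proof.
move=> Gu; elim: s => [|i s ih].
  by under eq_fun do rewrite big_nil; exact: measurable_wrt_rV_cst.
by under eq_fun do rewrite big_cons; exact: measurable_wrt_rVD.
Qed.

End measurable_wrt_rV.

Section square_integrable_vectors.
Context {d} {T : measurableType d} {R : realType} (P : probability T R) {m :
  nat}.
Implicit Types (u v z : T -> 'rV[R]_m) (G : set (set T)).

Lemma sqint_rV_cst (c : 'rV[R]_m) : sqint_rV P (fun=> c).
Proof. by move=> j; exact: sqint_cst. Qed.

Lemma sqint_rVD u v : sqint_rV P u -> sqint_rV P v -> sqint_rV P (fun w => u w
  + v w).
Proof. by move=> u2 v2 j; under eq_fun do rewrite mxE; exact: sqintD. Qed.

Lemma sqint_rVZ r u : sqint_rV P u -> sqint_rV P (fun w => r *: u w).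
Proof. by move=> u2 j; under eq_fun do rewrite mxE; exact: sqintZ. Qed.

Lemma sqint_rVN u : sqint_rV P u -> sqint_rV P (fun w => - u w).
Proof. by move=> u2 j; under eq_fun do rewrite mxE; exact: sqintN. Qed.

Lemma sqint_rVB u v : sqint_rV P u -> sqint_rV P v -> sqint_rV P (fun w => u w
  - v w).
Proof. by move=> u2 v2; apply: sqint_rVD => //; exact: sqint_rVN. Qed.

Lemma sqint_rV_sum I (s : seq I) (u : I -> T -> 'rV[R]_m) :
  (forall i, sqint_rV P (u i)) -> sqint_rV P (fun w => \sum_(i <- s) u i w).
Proof.
by move=> u2 j; under eq_fun do rewrite summxE; apply: sqint_sum => i;
  exact: u2.
Qed.

Lemma integrable_dotv u v : sqint_rV P u -> sqint_rV P v ->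
  P.-integrable setT (fun w => (dotv (u w) (v w))%:E).
Proof.
move=> u2 v2.
have := integrable_sum measurableT (index_enum 'I_m) (P := xpredT)
  (fun j _ => sqintM (u2 j) (v2 j)).
by apply: eq_integrable => // w _ /=; rewrite sumEFin.
Qed.

Lemma le_sqint_rV u (f : T -> R) :
  (forall j, measurable_fun setT (fun w => u w 0 j)) ->
  (forall w, dotv (u w) (u w) <= f w) -> P.-integrable setT (EFin \o f) ->
  sqint_rV P u.
Proof.
move=> mu uf i_f j; apply: (le_sqint (mu j)) i_f => w.
exact: le_trans (coord_sqr_le_dotv _ _) (uf w).
Qed.

Lemma edot_ge0 u : 0 <= edot P u u.
Proof. by apply: Rintegral_ge0 => w _; exact: dotv_ge0. Qed.

Lemma edot_coord u v : sqint_rV P u -> sqint_rV P v ->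
  edot P u v = \sum_j \int[P]_w (u w 0 j * v w 0 j).
Proof. by move=> u2 v2; rewrite /edot Rintegral_sum// => j; exact: sqintM. Qed.

Lemma edotC u v : edot P u v = edot P v u.
Proof. by apply: eq_Rintegral => w _; exact: dotvC. Qed.

Lemma edot_suml (I : finType) (b : I -> T -> 'rV[R]_m) v :
  (forall i, sqint_rV P (b i)) -> sqint_rV P v ->
  edot P (fun w => \sum_i b i w) v = \sum_i edot P (b i) v.
Proof.
move=> b2 v2; rewrite /edot -Rintegral_sum => [|i]; last exact: integrable_dotv.
by apply: eq_Rintegral => w _; exact: dotv_suml.
Qed.

Lemma edotDZ (c : R) u v : sqint_rV P u -> sqint_rV P v ->
  \int[P]_w dotv (u w + c *: v w) (u w + c *: v w) =
  edot P u u + 2 * c * edot P u v + c ^+ 2 * edot P v v.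
Proof.
move=> u2 v2; have iuv := integrable_dotv u2 v2.
have iu := integrable_dotv u2 u2; have iv := integrable_dotv v2 v2.
rewrite (@eq_Rintegral _ _ _ _ _
  (fun w => dotv (u w) (u w) + 2 * c * dotv (u w) (v w) + c ^+ 2 * dotv (v w)
    (v w)));
  last by move=> w _; rewrite !dotvE (dotvC (v w)); ring.
have iu2 := integrableD measurableT iu (integrableZl measurableT (2 * c) iuv).
rewrite RintegralD//; last exact: (integrableZl measurableT (c ^+ 2) iv).
rewrite RintegralD//; last exact: (integrableZl measurableT (2 * c) iuv).
by rewrite !RintegralZl.
Qed.

Lemma edotBr u v z : sqint_rV P u -> sqint_rV P v -> sqint_rV P z ->
  edot P u (fun w => v w - z w) = edot P u v - edot P u z.
Proof.
move=> u2 v2 z2; rewrite /edot; under eq_Rintegral do rewrite !dotvE.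
by rewrite RintegralB//; exact: integrable_dotv.
Qed.

(** Parallelogram identity with the square of u + v dropped. *)
Lemma edotB_le u v : sqint_rV P u -> sqint_rV P v ->
  edot P (fun w => u w - v w) (fun w => u w - v w) <=
  2 * edot P u u + 2 * edot P v v.
Proof.
move=> u2 v2.
have := edotDZ (-1) u2 v2; under eq_Rintegral do rewrite scaleN1r.
have := edotDZ 1 u2 v2; under eq_Rintegral do rewrite scale1r.
have := edot_ge0 (fun w => u w + v w).
rewrite -/(edot P (fun w => u w + v w) _) -/(edot P (fun w => u w - v w) _).
by move=> uv0 uvE ->; rewrite uvE in uv0; lra.
Qed.

Lemma edot_average (I : finType) (r : R) (u : I -> T -> 'rV[R]_m) :
  (forall i, sqint_rV P (u i)) ->
  P.-integrable setT (fun w => (r * \sum_i dotv (u i w) (u i w))%:E) /\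
  \int[P]_w (r * \sum_i dotv (u i w) (u i w)) = r * \sum_i edot P (u i) (u i).
Proof.
move=> u2; have iu i := integrable_dotv (u2 i) (u2 i).
have is_u : P.-integrable setT (fun w => (\sum_i dotv (u i w) (u i w))%:E).
  have := integrable_sum measurableT (index_enum I) (P := xpredT) (fun i _ =>
    iu i).
  by apply: eq_integrable => // w _ /=; rewrite sumEFin.
split; first exact: (integrableZl measurableT r is_u).
by rewrite RintegralZl// Rintegral_sum.
Qed.

Lemma edot_pythagoras (I : finType) (c : R) u (b : I -> T -> 'rV[R]_m) :
  sqint_rV P u -> (forall i, sqint_rV P (b i)) ->
  (forall i, edot P u (b i) = 0) ->
  (forall i j, i != j -> edot P (b i) (b j) = 0) ->
  \int[P]_w dotv (u w + c *: \sum_i b i w) (u w + c *: \sum_i b i w)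
  = edot P u u + c ^+ 2 * \sum_i edot P (b i) (b i).
Proof.
move=> u2 b2 ub bb; have B2 := sqint_rV_sum (index_enum I) b2.
rewrite edotDZ// edotC edot_suml// big1 => [|i _]; last by rewrite edotC.
rewrite mulr0 addr0 edot_suml//; congr (_ + _ * _); apply: eq_bigr => i _.
rewrite edotC edot_suml// (bigD1 i)//= big1 ?addr0// => j ji.
exact: bb.
Qed.

Lemma edot_cond_expectation_eq0 G u z v : sigma_algebra setT G ->
  G `<=` measurable -> is_cond_expectation_rV P G u z ->
  sqint_rV P u -> sqint_rV P z -> sqint_rV P v -> measurable_wrt_rV G v ->
  edot P (fun w => u w - z w) v = 0.
Proof.
move=> sG Gm uz u2 z2 v2 Gv; rewrite edot_coord//; last exact: sqint_rVB.
rewrite big1// => j _; under eq_Rintegral do rewrite !mxE mulrBl.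
rewrite RintegralB//; [|exact: sqintM..].
by rewrite (cond_expectation_mul sG Gm (uz j) (u2 j) (z2 j) (v2 j) (Gv j))
  subrr.
Qed.

Lemma edot_cond_independent_eq0 n G (X Z : 'I_n -> T -> 'rV[R]_m) i j :
  sigma_algebra setT G -> G `<=` measurable -> cond_independent P G X ->
  (forall i, measurable_fun setT (X i)) ->
  (forall i, is_cond_expectation_rV P G (X i) (Z i)) ->
  (forall i, sqint_rV P (X i)) -> (forall i, sqint_rV P (Z i)) -> i != j ->
  edot P (fun w => X i w - Z i w) (fun w => X j w - Z j w) = 0.
Proof.
move=> sG Gm indX mX XZ X2 Z2 ij; rewrite edot_coord; [|exact: sqint_rVB..].
rewrite big1// => k _; under eq_Rintegral do rewrite !mxE.
have indk := cond_independent_coord sG Gm k ij mX indX.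
exact: (cond_independent2_uncorrelated sG Gm indk (X2 i k) (X2 j k) (Z2 i k)
  (Z2 j k) (XZ i k) (XZ j k)).
Qed.

End square_integrable_vectors.

(** * The recursion *)

(** Nonexpansiveness of the prox, compared with the point xs - gamma F(xs) that it maps to xs.
    Minimality of p along the segment to xs and the variational inequality tested at p give
    |delta|^2 <= <zeta, delta>; expanding |zeta - delta|^2 >= 0 concludes. *)
Lemma prox_sqdist_solution (R : realType) m (F : 'rV[R]_m -> 'rV[R]_m)
    (reg : 'rV[R]_m -> \bar R) (gamma : R) (xs z p : 'rV[R]_m) :
  proper_fun reg -> convex_efun reg -> 0 < gamma ->
  VI_solutions F reg xs -> is_prox gamma reg z p ->
  dotv (p - xs) (p - xs) <=
  dotv (z - (xs - gamma *: F xs)) (z - (xs - gamma *: F xs)).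
Proof.
move=> [regNy [x0 x0y]] conv gamma0 VIxs [_ prox_p].
have fin_p : reg p \is a fin_num.
  have {prox_p} := prox_p x0 I; rewrite fin_numE regNy/=.
  have : reg x0 \is a fin_num by rewrite fin_numE regNy/= lt_eqF.
  by move=> /fineK <-; case: (reg p).
(* Tested at p, where [reg] is finite, the variational inequality excludes [reg xs = +oo]. *)
have fin_s : reg xs \is a fin_num.
  have := VIxs p; rewrite fin_numE regNy/= -(fineK fin_p).
  by case: (reg xs).
have VI : 0 <= dotv (F xs) (p - xs) + fine (reg p) - fine (reg xs).
  by rewrite -lee_fin EFinB EFinD !fineK//; exact: VIxs.
set K := dotv (xs - p) (xs - p); have K0 : 0 <= K by exact: dotv_ge0.
pose A := 2 * gamma * (fine (reg p) - fine (reg xs)).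
pose B := 2 * dotv (p - z) (xs - p).
(* Minimality of p against the point at parameter t on the segment to xs, combined with convexity
   and divided by t. *)
have AB (t : R) : 0 < t -> t <= 1 -> A <= B + t * K.
  move=> t0 t1.
  have := conv xs p t (ltW t0) t1; set y := t *: xs + _ => reg_y.
  have fin_y : reg y \is a fin_num.
    rewrite fin_numE regNy/= lt_eqF//; apply: le_lt_trans reg_y _.
    by rewrite -(fineK fin_p) -(fineK fin_s) -!EFinM -EFinD ltry.
  move: reg_y; rewrite -(fineK fin_y) -(fineK fin_p) -(fineK fin_s).
  rewrite -!EFinM -EFinD lee_fin => reg_y.
  have := prox_p y I.
  rewrite -(fineK fin_y) -(fineK fin_p) -!EFinD lee_fin !enorm_sqr.
  have -> : dotv (y - z) (y - z) =
      dotv (p - z) (p - z) + t * (B + t * K).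
    rewrite (_ : y - z = (p - z) + t *: (xs - p)); last first.
      by rewrite /y; apply/rowP => j; rewrite !mxE; ring.
    rewrite /B /K; move: (p - z) (xs - p) => u v.
    by rewrite !dotvE (dotvC v u); ring.
  move=> prox_y.
  have : t * (fine (reg p) - fine (reg xs)) <= t * (B + t * K) / (2 * gamma) by
    lra.
  rewrite -mulrA ler_pM2l// ler_pdivlMr ?mulr_gt0//.
  by rewrite /A mulrC.
(* One choice replaces the limit t -> 0: if B < A, then t = (A - B) / (K + (A - B)) is at most 1 and
   t K < A - B. *)
have {}AB : A <= B.
  rewrite leNgt; apply/negP => BA.
  have e0 : 0 < K + (A - B) by lra.
  have := AB ((A - B) / (K + (A - B))) (divr_gt0 _ e0).
  rewrite subr_gt0 ler_pdivrMr// mul1r lerDr => /(_ BA K0).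
  apply/negP; rewrite -ltNge -ltrBrDl.
  rewrite mulrAC ltr_pdivrMr// ltr_pM2l ?subr_gt0//; lra.
have : dotv (z - p) (xs - p) <= gamma * dotv (F xs) (p - xs).
  have -> : dotv (z - p) (xs - p) = - (B / 2).
    by rewrite -(opprB p z) dotvNl /B; field.
  rewrite /A in AB; nra.
move=> main; set zeta := z - _; set delta := p - xs.
have : dotv delta delta <= dotv zeta delta.
  have zE : z - p = zeta - gamma *: F xs - delta.
    by rewrite /zeta /delta; apply/rowP => j; rewrite !mxE; ring.
  have dE : xs - p = - delta by rewrite opprB.
  move: main; rewrite zE dE -/delta {zE dE}; move: zeta delta => u v;
    rewrite !dotvE; lra.
move: zeta delta {main} => u v; have := dotv_ge0 (u - v).
by rewrite !dotvE (dotvC v u); lra.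
Qed.

(** * Compression errors of all workers *)

Section compression_error.
Context {d} {T : measurableType d} {R : realType} (P : probability T R).
Variables (G : set (set T)) (n m : nat) (omega : R).
Variable (Q : R.-pker 'rV[R]_m ~> 'rV[R]_m).
Hypotheses (sG : sigma_algebra setT G) (Gm : G `<=` measurable).
Hypothesis omega_ge0 : 0 <= omega.
Hypothesis Q_compressor : unbiased_compressor omega Q.
Variables (D X : 'I_n -> T -> 'rV[R]_m).
Hypotheses (GD : forall i, measurable_wrt G (D i)).
Hypothesis mX : forall i, measurable_fun setT (X i).
Hypothesis XQ : forall i, cond_distributed P G Q (D i) (X i).
Hypothesis indX : cond_independent P G X.
(* For omega = 0 nothing bounds the second moment of the input, but then the
   compressor is exact almost surely. *)
Hypothesis D2 : omega != 0 -> forall i, sqint_rV P (D i).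

Let e i w := X i w - D i w.

Let mD i : measurable_fun setT (D i).
Proof. exact: (measurable_wrt_sub Gm (@GD i)). Qed.

Let mcoord (u : T -> 'rV[R]_m) j : measurable_fun setT u ->
  measurable_fun setT (fun w => u w 0 j).
Proof. by move=> mu; exact: (measurableT_comp (measurable_coord j) mu). Qed.

Let me i j : measurable_fun setT (fun w => e i w 0 j).
Proof. by under eq_fun do rewrite !mxE; apply: measurable_funB;
  exact: mcoord. Qed.

Let e0 i : omega = 0 -> {ae P, forall w, e i w = 0}.
Proof.
move=> omega0.
have := compressed_exact Gm Q_compressor (@GD i) (@mX i) (@XQ i) omega0.
by apply: filterS => w; rewrite /e => ->; rewrite subrr.
Qed.

Lemma sqint_compressed_rV i : omega != 0 -> sqint_rV P (X i).
Proof.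
move=> omega0 j.
exact: (sqint_compressed sG Gm omega_ge0 Q_compressor (@GD i) (@mX i) (@XQ i)
  (@D2 omega0 i)).
Qed.

Let Xexp i : omega != 0 -> is_cond_expectation_rV P G (X i) (D i).
Proof.
move=> omega0 j.
exact: (compressed_cond_expectation sG Gm omega_ge0 Q_compressor (@GD i) (@mX i)
  (@XQ i) (@D2 omega0 i)).
Qed.

(** For [omega = 0] neither X nor D need be square integrable, but their difference vanishes almost
    surely. *)
Lemma sqint_compression_error i : sqint_rV P (e i).
Proof.
have [omega0|omega0] := eqVneq omega 0; last first.
  by apply: sqint_rVB; [exact: sqint_compressed_rV|exact: D2].
move=> j; apply: sqint_bounded; first exact: me.
by apply: filterS (e0 i omega0) => w ->; rewrite mxE lexx ler01.
Qed.

Let edot_ae0 u i : sqint_rV P u -> omega = 0 -> edot P u (e i) = 0.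
Proof.
move=> u2 omega0; have iue := integrable_dotv u2 (sqint_compression_error i).
rewrite /edot /Rintegral (ae_eq_integral (cst 0%E))//;
  first by rewrite integral0.
  exact: measurable_int iue.
apply: filterS (e0 i omega0) => w -> _ /=.
by rewrite dotvC -(scale0r 0) dotvZl mul0r.
Qed.

Lemma compression_error_orthogonal u i : sqint_rV P u -> measurable_wrt_rV G u
  ->
  edot P u (e i) = 0.
Proof.
move=> u2 Gu; have [omega0|omega0] := eqVneq omega 0; first exact: edot_ae0.
rewrite edotC (edot_cond_expectation_eq0 sG Gm (Xexp i omega0))//.
  exact: sqint_compressed_rV.
exact: D2.
Qed.

Lemma compression_errors_uncorrelated i j : i != j -> edot P (e i) (e j) = 0.
Proof.
move=> ij; have [omega0|omega0] := eqVneq omega 0.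
  by apply: edot_ae0 => //; exact: sqint_compression_error.
apply: (edot_cond_independent_eq0 sG Gm indX mX) => // k.
- exact: Xexp.
- exact: sqint_compressed_rV.
- exact: D2.
Qed.

Lemma compressed_edot_le i : omega != 0 ->
  edot P (X i) (X i) <= (1 + omega) * edot P (D i) (D i).
Proof.
move=> omega0; have X2 := sqint_compressed_rV i omega0.
rewrite -lee_fin EFin_Rintegral//; last exact: integrable_dotv.
exact: (compressed_second_moment sG Gm omega_ge0 Q_compressor (@GD i) (@mX i)
  (@XQ i) (@D2 omega0 i)).
Qed.

(** X = D + e is an orthogonal sum, so E|e|^2 = E|X|^2 - E|D|^2, which the second moment bound
    controls. For [omega = 0] both sides are 0. *)
Lemma compression_error_edot_le i : edot P (e i) (e i) <= omega * edot P (D i)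
  (D i).
Proof.
have [omega0|omega0] := eqVneq omega 0.
  by rewrite edot_ae0 ?omega0 ?mul0r//; exact: sqint_compression_error.
have X2 := sqint_compressed_rV i omega0.
have De : edot P (D i) (e i) = 0.
  apply: compression_error_orthogonal; first exact: D2.
  exact/measurable_wrt_rVP.
have := edotDZ 1 (@D2 omega0 i) (sqint_compression_error i).
rewrite De mulr0 addr0 expr1n mul1r.
under eq_Rintegral do rewrite scale1r /e addrC subrK.
by have := compressed_edot_le i omega0; rewrite /edot; lra.
Qed.

End compression_error.

(** * Averages, and the scalar inequality behind one step *)

Lemma averageD (R : realType) m n (u v : 'I_n -> 'rV[R]_m) :
  average (fun i => u i + v i) = average u + average v.
Proof. by rewrite /average big_split scalerDr. Qed.

Lemma averageZ (R : realType) m n r (u : 'I_n -> 'rV[R]_m) :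
  average (fun i => r *: u i) = r *: average u.
Proof. by rewrite /average -scaler_sumr scalerA mulrC -scalerA. Qed.

Lemma averageB (R : realType) m n (u v : 'I_n -> 'rV[R]_m) :
  average (fun i => u i - v i) = average u - average v.
Proof.
rewrite -scaleN1r -averageZ -averageD; congr average; apply/funext => i.
by rewrite scaleN1r.
Qed.

(** The squared deviations from the average have a nonnegative sum. *)
Lemma dotv_average_le (R : realType) m n (u : 'I_n -> 'rV[R]_m) : (0 < n)%N ->
  dotv (average u) (average u) <= n%:R^-1 * \sum_i dotv (u i) (u i).
Proof.
move=> n0; have n0' : (0 : R) < n%:R by rewrite ltr0n.
have : \sum_i u i = n%:R *: average u.
  by rewrite /average scalerA mulfV ?scale1r// gt_eqF.
move: (average u) => a sumE.
have : 0 <= \sum_i dotv (u i - a) (u i - a) by apply: sumr_ge0 => i _;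
  exact: dotv_ge0.
rewrite (eq_bigr (fun i => dotv (u i) (u i) + (-2) * dotv (u i) a + dotv a a));
  last by move=> i _; rewrite !dotvE (dotvC a); ring.
rewrite !big_split/= -mulr_sumr -dotv_suml sumE dotvZl sumr_const card_ord.
rewrite -[_ *+ n]mulr_natl ler_pdivlMl//; lra.
Qed.

(* A, H, D, S stand for the expectations of |x - xs|^2 and of the averages of
   |h_i - F_i xs|^2, |F_i x - F_i xs|^2 and |g_i - F_i x|^2, B for that of
   <F x - F xs, x - xs> and delta for that of the average of |Delta_i|^2. *)
Lemma lyapunov_decrease (R : realType) (n omega alpha gamma ell mu rho : R)
    (A A' B D S H H' delta sigma2 : R) :
  0 < n -> 0 <= omega -> 0 < alpha -> 0 < gamma -> 0 < ell ->
  gamma <= 1 / ((1 + 6 * omega / n) * ell) ->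
  rho <= gamma * mu -> rho <= alpha / 2 ->
  0 <= A -> 0 <= H -> 0 <= B -> S <= sigma2 -> D <= ell * B -> mu * A <= B ->
  A' <= A - 2 * gamma * B + gamma ^+ 2 * D
        + gamma ^+ 2 / n * S + gamma ^+ 2 / n * (omega * delta) ->
  omega * delta <= omega * (S + 2 * D + 2 * H) ->
  omega * H' <= omega * ((1 - alpha) * H + alpha * (S + D)) ->
  A' + 4 * omega * gamma ^+ 2 * H' / (alpha * n) <=
  (1 - rho) * (A + 4 * omega * gamma ^+ 2 * H / (alpha * n))
  + gamma ^+ 2 * sigma2 * (1 + 5 * omega) / n.
Proof.
move=> n0 omega0 alpha0 gamma0 ell0 gamma_le rho1 rho2 A0 H0 B0 S_le D_le mu_le
  A'_le delta_le H'_le.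
pose c := gamma ^+ 2 / n; have c0 : 0 < c by rewrite divr_gt0// exprn_gt0.
(* Origin of the 6 in the stepsize: beside gamma^2 D, the term c omega D enters twice through delta
   and four times through the new shifts. The stepsize bounds the total by gamma B, half of the
   available 2 gamma B. *)
have cD : gamma ^+ 2 * D + 6 * omega * c * D <= gamma * B.
  have -> : gamma ^+ 2 * D + 6 * omega * c * D =
    gamma * (gamma * (1 + 6 * omega / n)) * D by rewrite /c; field;
      rewrite gt_eqF.
  have k0 : 0 < 1 + 6 * omega / n.
    by rewrite ltr_pwDl// divr_ge0 ?mulr_ge0// ltW.
  have gk : gamma * (1 + 6 * omega / n) * ell <= 1.
    by move: gamma_le; rewrite ler_pdivlMr ?mulr_gt0// mulrA.
  rewrite -mulrA ler_pM2l//; apply: (@le_trans _ _ (gamma * (1 + 6 * omega / n)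
    * (ell * B))).
    by rewrite ler_pM2l// mulr_gt0.
  by rewrite mulrA ler_piMl.
have MH h : 4 * omega * gamma ^+ 2 * h / (alpha * n) = 4 * c / alpha * (omega *
  h).
  by rewrite /c; field; rewrite !gt_eqF.
rewrite !MH.
have ca0 : 0 < 4 * c / alpha by rewrite divr_gt0// mulr_gt0.
have e1 : 4 * c / alpha * (omega * H') <=
    4 * c / alpha * (omega * ((1 - alpha) * H + alpha * (S + D))).
  by rewrite ler_pM2l.
have e2 : c * (omega * delta) <= c * (omega * (S + 2 * D + 2 * H)).
  by rewrite ler_pM2l.
set M := 4 * c / alpha in ca0 e1 *.
(* The weight 4 / alpha makes the contraction of H worth 4 c omega H, twice what delta costs; the
   surplus 2 c omega H is the rate alpha / 2 (see [e5]). *)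
have Ma : M * alpha = 4 * c by rewrite /M; field; rewrite gt_eqF.
have e3 : M * (omega * ((1 - alpha) * H + alpha * (S + D))) =
    M * (omega * H) - 4 * c * omega * H + 4 * c * omega * (S + D).
  by rewrite -Ma; ring.
(* The other half of 2 gamma B pays for the contraction of A. *)
have e4 : rho * A <= gamma * B.
  apply: le_trans (_ : gamma * mu * A <= _); first exact: ler_wpM2r.
  by rewrite -mulrA ler_pM2l.
have e5 : rho * (M * (omega * H)) <= 2 * c * (omega * H).
  have -> : 2 * c = alpha / 2 * M by lra.
  by rewrite mulrA; apply: ler_wpM2r; [exact: mulr_ge0|rewrite ler_pM2r].
(* In 1 + 5 omega, 1 is the noise itself, omega comes through delta and 4 omega through the new
   shifts. *)
have e6 : c * (1 + 5 * omega) * S <= c * (1 + 5 * omega) * sigma2.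
  by apply: ler_wpM2l => //; apply: mulr_ge0; [exact: ltW|lra].
have -> : gamma ^+ 2 * sigma2 * (1 + 5 * omega) / n = c * (1 + 5 * omega) *
  sigma2.
  by rewrite /c; ring.
rewrite -/c in A'_le; lra.
Qed.

(** * One iteration of the method *)

Section diana_step.
Context {R : realType} {m n : nat} (n_gt0 : (0 < n)%N).
Variables (Fi : 'I_n -> 'rV[R]_m -> 'rV[R]_m) (F : 'rV[R]_m -> 'rV[R]_m).
Hypothesis F_average : forall y, F y = average (fun i => Fi i y).
Variables (xs : 'rV[R]_m) (mu ell : R).
Hypotheses (mu_gt0 : 0 < mu) (ell_gt0 : 0 < ell).
Hypothesis F_monotone : quasi_strongly_monotone mu F [set xs].
Hypothesis Fi_cocoercive : average_star_cocoercive ell Fi [set xs].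

Let n0 : (0 : R) < n%:R. Proof. by rewrite ltr0n. Qed.

Let proj_xs y : is_proj [set xs] y xs.
Proof. by split=> // z ->. Qed.

Lemma monotone_at y : mu * dotv (y - xs) (y - xs) <= dotv (F y - F xs) (y - xs).
Proof. by rewrite -enorm_sqr; exact: F_monotone. Qed.

Lemma cocoercive_at y :
  n%:R^-1 * (\sum_i dotv (Fi i y - Fi i xs) (Fi i y - Fi i xs)) <=
  ell * dotv (F y - F xs) (y - xs).
Proof.
rewrite !F_average; under eq_bigr do rewrite -enorm_sqr.
exact: Fi_cocoercive.
Qed.

Lemma F_subE y : F y - F xs = average (fun i => Fi i y - Fi i xs).
Proof. by rewrite averageB !F_average. Qed.

Lemma dotv_F_sub_le y : dotv (F y - F xs) (F y - F xs) <=
  n%:R^-1 * (\sum_i dotv (Fi i y - Fi i xs) (Fi i y - Fi i xs)).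
Proof. by rewrite F_subE; exact: dotv_average_le. Qed.

(** With u = F y - F xs, v = y - xs and D the average of the squares, |u|^2 <= D <= ell <u, v>;
    expanding |u - ell v|^2 >= 0 gives D <= ell^2 |v|^2. This is the source of the square
    integrability of [phi]. *)
Lemma sum_F_sub_le y :
  \sum_i dotv (Fi i y - Fi i xs) (Fi i y - Fi i xs) <=
  n%:R * (ell ^+ 2 * dotv (y - xs) (y - xs)).
Proof.
have := cocoercive_at y; have := dotv_F_sub_le y.
set D := n%:R^-1 * _ => FD DF; rewrite -ler_pdivrMl// -/D.
have := dotv_ge0 ((F y - F xs) - ell *: (y - xs)).
move: (F y - F xs) (y - xs) FD DF => u v FD DF.
by rewrite !dotvE (dotvC v u); lra.
Qed.

Context {disp} {Omega : measurableType disp} {P : probability Omega R}.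

(* G0 is the information available before the iteration, G1 includes the
   stochastic estimates; the new iterate is controlled through the argument
   of the proximal operator. *)
Variables (omega alpha gamma : R) (Q : R.-pker 'rV[R]_m ~> 'rV[R]_m).
Hypotheses (omega_ge0 : 0 <= omega) (Q_compressor : unbiased_compressor omega
  Q).
Hypotheses (alpha_gt0 : 0 < alpha) (alpha_le : alpha <= 1 / (1 + omega)).
Variables (G0 G1 : set (set Omega)).
Hypotheses (sG0 : sigma_algebra setT G0) (sG1 : sigma_algebra setT G1).
Hypotheses (G01 : G0 `<=` G1) (G1m : G1 `<=` measurable).
Variables (x : Omega -> 'rV[R]_m) (h g q : 'I_n -> Omega -> 'rV[R]_m).
Hypotheses (G0x : measurable_wrt_rV G0 x).
Hypotheses (G0h : forall i, measurable_wrt_rV G0 (h i)).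
Hypotheses (G1g : forall i, measurable_wrt_rV G1 (g i)).
Hypotheses (mg : forall i, measurable_fun setT (g i)).
Hypotheses (mq : forall i, measurable_fun setT (q i)).
Hypothesis g_indep : cond_independent P G0 g.
Hypothesis q_law : forall i, cond_distributed P G1 Q (fun w => g i w - h i w)
  (q i).
Hypothesis q_indep : cond_independent P G1 q.
Variable sigma : 'I_n -> R.
Hypothesis g_unbiased : forall i,
  is_cond_expectation_rV P G0 (g i) (fun w => Fi i (x w)).
Hypothesis g_variance : forall i, cond_expectation_le P G0
  (fun w => enorm (g i w - Fi i (x w)) ^+ 2) (sigma i ^+ 2).
Hypothesis x2 : sqint_rV P (fun w => x w - xs).
Hypothesis h2 : omega != 0 -> forall i, sqint_rV P (fun w => h i w - Fi i xs).

Let G0m : G0 `<=` measurable. Proof. exact: subset_trans G01 G1m. Qed.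

Let xe w := x w - xs.
Let phi i w := Fi i (x w) - Fi i xs.
Let xi i w := g i w - Fi i (x w).
Let eta i w := h i w - Fi i xs.
Let Delta i w := g i w - h i w.
Let e i w := q i w - Delta i w.
Let f w := F (x w) - F xs.
Let a w := xe w - gamma *: f w.
Let c := - (gamma / n%:R).
(** The prox argument relative to xs - gamma F(xs), without the compression errors: the part known
    once the estimates are. *)
Let b w := a w + c *: \sum_i xi i w.

(** Measurability of F_i(x) is read off from its being a version of a conditional expectation given
    [G0]. *)
Let G0F i : measurable_wrt_rV G0 (fun w => Fi i (x w)).
Proof. by move=> j; case: (@g_unbiased i j). Qed.

Let G0phi i : measurable_wrt_rV G0 (phi i).
Proof. by apply: measurable_wrt_rVB => //; exact: measurable_wrt_rV_cst. Qed.

Let G0eta i : measurable_wrt_rV G0 (eta i).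
Proof. by apply: measurable_wrt_rVB => //; exact: measurable_wrt_rV_cst. Qed.

Let fE : f = fun w => n%:R^-1 *: \sum_i phi i w.
Proof. by apply/funext => w; rewrite /f F_subE. Qed.

Let G0a : measurable_wrt_rV G0 a.
Proof.
apply: measurable_wrt_rVB => //.
  by apply: measurable_wrt_rVB => //; exact: measurable_wrt_rV_cst.
apply: measurable_wrt_rVZ => //.
rewrite fE; by apply: measurable_wrt_rVZ => //; exact: measurable_wrt_rV_sum.
Qed.

Let G1sub (u : Omega -> 'rV[R]_m) : measurable_wrt_rV G0 u -> measurable_wrt_rV
  G1 u.
Proof. by move=> Gu j; exact: sub_measurable_wrt (Gu j). Qed.

Let G1xi i : measurable_wrt_rV G1 (xi i).
Proof. by apply: measurable_wrt_rVB => //; exact: G1sub. Qed.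

Let G1b : measurable_wrt_rV G1 b.
Proof.
apply: measurable_wrt_rVD => //; first exact: G1sub.
by apply: measurable_wrt_rVZ => //; exact: measurable_wrt_rV_sum.
Qed.

Let G1Delta i : measurable_wrt G1 (Delta i).
Proof.
apply/(measurable_wrt_rVP sG1); apply: measurable_wrt_rVB => //.
exact: G1sub.
Qed.

Let phi2 i : sqint_rV P (phi i).
Proof.
apply: (@le_sqint_rV _ _ _ _ _ _
  (fun w => n%:R * (ell ^+ 2 * dotv (xe w) (xe w)))).
- by move=> j; exact: (measurable_wrt_sub G0m (@G0phi i j)).
- move=> w; apply: le_trans (sum_F_sub_le (x w)).
  by rewrite (bigD1 i)//= lerDl sumr_ge0// => k _; exact: dotv_ge0.
- have := integrableZl measurableT n%:R
    (integrableZl measurableT (ell ^+ 2) (integrable_dotv x2 x2)).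
  by apply: eq_integrable => // w _ /=; rewrite !EFinM.
Qed.

Let f2 : sqint_rV P f.
Proof.
rewrite fE; by apply: sqint_rVZ; exact: sqint_rV_sum.
Qed.

Let a2 : sqint_rV P a.
Proof. by apply: sqint_rVB => //; exact: sqint_rVZ. Qed.

Let xi2 i : sqint_rV P (xi i).
Proof.
have [Y [iX _ _ _] _] := @g_variance i.
apply: le_sqint_rV iX.
- by move=> j; exact: (measurable_wrt_sub G1m (@G1xi i j)).
- by move=> w; rewrite -enorm_sqr.
Qed.

Let xi_le i : edot P (xi i) (xi i) <= sigma i ^+ 2.
Proof.
have [Y [iX iY GY XY] Ys] := @g_variance i.
have GT : G0 setT by case: sG0 => S0 SC _; rewrite -[setT]setD0; exact: SC.
have -> : edot P (xi i) (xi i) = \int[P]_w Y w.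
  by rewrite /Rintegral -(XY _ GT); congr fine; apply: eq_integral => w _;
    rewrite enorm_sqr.
have is_s : P.-integrable setT (EFin \o (fun=> sigma i ^+ 2)).
  exact: sqint_integrable (sqint_cst P _).
have : 0 <= \int[P]_w (sigma i ^+ 2 - Y w).
  apply: Rintegral_ae_ge0.
    apply: measurable_funB => //; exact/measurable_EFinP/(measurable_int _ iY).
  by apply: filterS Ys => w Yw; rewrite subr_ge0.
rewrite RintegralB// Rintegral_cst//.
have -> : fine (P setT) = 1 by rewrite probability_setT.
rewrite mulr1 subr_ge0.
by [].
Qed.

Let g2 i : sqint_rV P (g i).
Proof.
have : sqint_rV P (fun w => xi i w + phi i w + Fi i xs).
  apply: sqint_rVD; last exact: sqint_rV_cst.
  exact: sqint_rVD.
by under eq_fun do rewrite /xi /phi addrA !subrK.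
Qed.

Let Fi2 i : sqint_rV P (fun w => Fi i (x w)).
Proof.
have := sqint_rVD (@phi2 i) (sqint_rV_cst P (Fi i xs)).
by under eq_fun do rewrite subrK.
Qed.

Let edot_xi_eq0 i (u : Omega -> 'rV[R]_m) : sqint_rV P u ->
  measurable_wrt_rV G0 u -> edot P u (xi i) = 0.
Proof.
by move=> u2 Gu; rewrite edotC; exact: (edot_cond_expectation_eq0 sG0 G0m
  (@g_unbiased i)).
Qed.

Let edot_xi_xi i j : i != j -> edot P (xi i) (xi j) = 0.
Proof. exact: (edot_cond_independent_eq0 sG0 G0m g_indep mg g_unbiased g2 Fi2).
  Qed.

Let Delta2 : omega != 0 -> forall i, sqint_rV P (Delta i).
Proof.
move=> omega0 i; have := sqint_rVB (@g2 i) (sqint_rVD (@h2 omega0 i)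
  (sqint_rV_cst P (Fi i xs))).
by under eq_fun do rewrite subrK.
Qed.

Let e2 i : sqint_rV P (e i).
Proof. exact: (sqint_compression_error sG1 G1m omega_ge0 Q_compressor G1Delta
  mq q_law). Qed.

Let b2 : sqint_rV P b.
Proof. by apply: sqint_rVD => //; apply: sqint_rVZ; exact: sqint_rV_sum. Qed.

Lemma sqint_prox_argument : sqint_rV P (fun w => b w + c *: \sum_i e i w).
Proof. by apply: sqint_rVD => //; apply: sqint_rVZ; exact: sqint_rV_sum. Qed.

Let A := edot P xe xe.
Let B := edot P f xe.
Let S := n%:R^-1 * \sum_i edot P (xi i) (xi i).
Let D := n%:R^-1 * \sum_i edot P (phi i) (phi i).
Let H := n%:R^-1 * \sum_i edot P (eta i) (eta i).
Let delta := n%:R^-1 * \sum_i edot P (Delta i) (Delta i).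

(** Pythagoras in two layers: given [G1] the compression errors split off from [b], then given [G0]
    the noises split off from [a]. Only n squares survive against c^2 = gamma^2 / n^2, whence the
    factors 1 / n. *)
Lemma prox_argument_edot_le :
  \int[P]_w dotv (b w + c *: \sum_i e i w) (b w + c *: \sum_i e i w) <=
  A - 2 * gamma * B + gamma ^+ 2 * D
  + gamma ^+ 2 / n%:R * S + gamma ^+ 2 / n%:R * (omega * delta).
Proof.
rewrite edot_pythagoras//; last 2 first.
- move=> i; exact: (compression_error_orthogonal sG1 G1m omega_ge0 Q_compressor
    G1Delta mq q_law).
- exact: (compression_errors_uncorrelated sG1 G1m omega_ge0 Q_compressor
    G1Delta mq q_law q_indep).
rewrite {1}/edot edot_pythagoras//; last first.
  by move=> i; exact: edot_xi_eq0.
have -> : edot P a a = A - 2 * gamma * B + gamma ^+ 2 * edot P f f.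
  have := edotDZ (- gamma) x2 f2.
  under eq_Rintegral do rewrite scaleNr.
  rewrite -/(edot P a a) => ->.
  by rewrite -/xe -/A (edotC P xe) -/B; ring.
have ffD : edot P f f <= D.
  rewrite /D; have [iD <-] := edot_average n%:R^-1 phi2.
  apply: le_Rintegral => //; first exact: integrable_dotv.
  by move=> w _; exact: dotv_F_sub_le.
have eD : \sum_i edot P (e i) (e i) <= omega * \sum_i edot P (Delta i) (Delta
  i).
  rewrite mulr_sumr; apply: ler_sum => i _.
  exact: (compression_error_edot_le sG1 G1m omega_ge0 Q_compressor G1Delta mq
    q_law).
have -> : gamma ^+ 2 / n%:R * S =
    c ^+ 2 * \sum_i edot P (xi i) (xi i) by rewrite /S /c; field;
      rewrite gt_eqF.
have -> : gamma ^+ 2 / n%:R * (omega * delta) =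
    c ^+ 2 * (omega * \sum_i edot P (Delta i) (Delta i)).
  by rewrite /delta /c; field; rewrite gt_eqF.
apply: lerD; last by rewrite ler_wpM2l ?sqr_ge0.
by rewrite lerD2r lerD2l ler_wpM2l ?sqr_ge0.
Qed.

(** alpha (1 + omega) <= 1 gives alpha^2 E|q|^2 <= alpha E|Delta|^2. Then 2 <eta, Delta> + |Delta|^2
    = |eta + Delta|^2 - |eta|^2, and eta + Delta = xi + phi is an orthogonal sum. *)
Lemma shift_edot_le i : omega != 0 ->
  edot P (fun w => h i w + alpha *: q i w - Fi i xs)
         (fun w => h i w + alpha *: q i w - Fi i xs) <=
  (1 - alpha) * edot P (eta i) (eta i)
  + alpha * (edot P (xi i) (xi i) + edot P (phi i) (phi i)).
Proof.
move=> omega0.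
have eta2 := @h2 omega0 i; have Del2 := @Delta2 omega0 i.
have q2 : sqint_rV P (q i).
  exact: (sqint_compressed_rV sG1 G1m omega_ge0 Q_compressor G1Delta mq q_law
    Delta2).
have qq : edot P (q i) (q i) <= (1 + omega) * edot P (Delta i) (Delta i).
  exact: (compressed_edot_le sG1 G1m omega_ge0 Q_compressor G1Delta mq q_law
    Delta2).
have eq_ : edot P (eta i) (q i) = edot P (eta i) (Delta i).
  apply/eqP; rewrite -subr_eq0 -edotBr//; apply/eqP.
  apply: (compression_error_orthogonal sG1 G1m omega_ge0 Q_compressor
    G1Delta mq q_law Delta2) => //; exact: G1sub.
have -> : (fun w => h i w + alpha *: q i w - Fi i xs) =
    (fun w => eta i w + alpha *: q i w).
  by apply/funext => w; rewrite /eta addrAC.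
rewrite {1}/edot edotDZ// eq_.
have := edotDZ 1 eta2 Del2; have := edotDZ 1 (@xi2 i) (@phi2 i).
have -> : (fun w => dotv (eta i w + 1 *: Delta i w) (eta i w + 1 *: Delta i w))
  =
    (fun w => dotv (xi i w + 1 *: phi i w) (xi i w + 1 *: phi i w)).
  apply/funext => w; rewrite !scale1r; congr dotv; rewrite /eta /xi /phi /Delta;
    by apply/rowP => j; rewrite !mxE; ring.
rewrite (edotC P (xi i)) (edot_xi_eq0 i (@phi2 i) (@G0phi i)) => -> eta_Delta.
have : alpha ^+ 2 * edot P (q i) (q i) <= alpha * edot P (Delta i) (Delta i).
  rewrite expr2 -mulrA ler_pM2l//; apply: (@le_trans _ _
    (alpha * ((1 + omega) * edot P (Delta i) (Delta i))));
      first by rewrite ler_pM2l.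
  rewrite mulrA ler_piMl ?edot_ge0//.
  by rewrite -ler_pdivlMr// ltr_pwDl.
move: eta_Delta; rewrite -/(eta i); nra.
Qed.

(** Delta = xi + (phi - eta) is an orthogonal sum, and the square of phi - eta costs a factor 2. The
    factor [omega] stays on both sides to cover [omega = 0], where Delta need not be square
    integrable. *)
Lemma delta_le : omega * delta <= omega * (S + 2 * D + 2 * H).
Proof.
have [->|omega0] := eqVneq omega 0; first by rewrite !mul0r.
apply: ler_wpM2l => //.
have -> : S + 2 * D + 2 * H = n%:R^-1 * \sum_i (edot P (xi i) (xi i)
    + 2 * edot P (phi i) (phi i) + 2 * edot P (eta i) (eta i)).
  by rewrite !big_split/= -!mulr_sumr /S /D /H; ring.
rewrite ler_pM2l ?invr_gt0//; apply: ler_sum => i _.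
have eta2 := @h2 omega0 i.
have d2 : sqint_rV P (fun w => phi i w - eta i w) by exact: sqint_rVB.
have := edotDZ 1 (@xi2 i) d2.
have -> : (fun w => dotv (xi i w + 1 *: (phi i w - eta i w)) (xi i w + 1 *:
  (phi i w - eta i w))) =
    (fun w => dotv (Delta i w) (Delta i w)).
  apply/funext => w; rewrite !scale1r; congr dotv; rewrite /eta /xi /phi /Delta;
    by apply/rowP => j; rewrite !mxE; ring.
rewrite (edotC P (xi i)) (edot_xi_eq0 i d2); last first.
  by apply: measurable_wrt_rVB.
by have := edotB_le (@phi2 i) eta2; rewrite -/(edot P (Delta i) _); lra.
Qed.

Lemma prox_argumentE w : b w + c *: \sum_i e i w =
  x w - gamma *: (average (fun i => h i w) + average (fun i => q i w))
  - (xs - gamma *: F xs).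
Proof.
have cE (u : 'I_n -> 'rV[R]_m) : c *: \sum_i u i = - gamma *: average u.
  by rewrite /average scalerA mulNr.
rewrite /b !cE /e /Delta /xi !averageB -F_average /a /f /xe.
move: (x w) (F xs) (F _) (average _) (average _) (average _) => u1 u2 u3 u4 u5
  u6.
by apply/rowP => j; rewrite !mxE; ring.
Qed.

Section new_iterate.
Variables (rho : R) (x' : Omega -> 'rV[R]_m).
Hypotheses (gamma_gt0 : 0 < gamma)
  (gamma_le : gamma <= 1 / ((1 + 6 * omega / n%:R) * ell)).
Hypotheses (rho_le1 : rho <= gamma * mu) (rho_le2 : rho <= alpha / 2).
Hypothesis mx' : measurable_fun setT x'.
Hypothesis x'_le : forall w, dotv (x' w - xs) (x' w - xs) <=
  let z := x w - gamma *: (average (fun i => h i w) + average (fun i => q i w))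
           - (xs - gamma *: F xs) in dotv z z.

Let h' i w := h i w + alpha *: q i w.

Let x'_leb w : dotv (x' w - xs) (x' w - xs) <=
  dotv (b w + c *: \sum_i e i w) (b w + c *: \sum_i e i w).
Proof. by rewrite prox_argumentE; exact: x'_le. Qed.

Lemma sqint_new_iterate : sqint_rV P (fun w => x' w - xs).
Proof.
have z2 := sqint_prox_argument; have := integrable_dotv z2 z2.
apply: le_sqint_rV; last exact: x'_leb.
move=> j; under eq_fun do rewrite !mxE; apply: measurable_funB => //.
exact: (measurableT_comp (measurable_coord j) mx').
Qed.

Lemma sqint_new_shift i : omega != 0 -> sqint_rV P (fun w => h' i w - Fi i xs).
Proof.
move=> omega0.
have q2 : sqint_rV P (q i).
  exact: (sqint_compressed_rV sG1 G1m omega_ge0 Q_compressor G1Delta mq q_law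
    Delta2).
have := sqint_rVD (@h2 omega0 i) (sqint_rVZ alpha q2).
by under eq_fun do rewrite addrAC.
Qed.

Lemma diana_step_le :
  edot P (fun w => x' w - xs) (fun w => x' w - xs)
  + 4 * omega * gamma ^+ 2 * (n%:R^-1 * \sum_i
      edot P (fun w => h' i w - Fi i xs) (fun w => h' i w - Fi i xs))
    / (alpha * n%:R) <=
  (1 - rho) * (edot P (fun w => x w - xs) (fun w => x w - xs)
    + 4 * omega * gamma ^+ 2 * (n%:R^-1 * \sum_i
        edot P (fun w => h i w - Fi i xs) (fun w => h i w - Fi i xs))
      / (alpha * n%:R))
  + gamma ^+ 2 * (n%:R^-1 * \sum_i sigma i ^+ 2) * (1 + 5 * omega) / n%:R.
Proof.
have muB : mu * A <= B.
  rewrite /A /B -RintegralZl//; last exact: integrable_dotv.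
  apply: le_Rintegral => //; last by move=> w _; exact: monotone_at.
    exact: (integrableZl measurableT mu (integrable_dotv x2 x2)).
  exact: integrable_dotv.
have DB : D <= ell * B.
  rewrite /D /B -RintegralZl//; last exact: integrable_dotv.
  have [iD <-] := edot_average n%:R^-1 phi2.
  apply: le_Rintegral => //; last by move=> w _; exact: cocoercive_at.
  exact: (integrableZl measurableT ell (integrable_dotv f2 x2)).
apply: (lyapunov_decrease (D := D) (S := S) (B := B) (delta := delta)
  n0 omega_ge0 alpha_gt0 gamma_gt0 ell_gt0 gamma_le rho_le1 rho_le2) => //.
- exact: edot_ge0.
- by apply: mulr_ge0; [rewrite invr_ge0|apply: sumr_ge0 => i _;
  exact: edot_ge0].
- by apply: le_trans muB; apply: mulr_ge0; [exact: ltW|exact: edot_ge0].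
- by rewrite ler_pM2l ?invr_gt0//; apply: ler_sum.
- apply: le_trans prox_argument_edot_le; have z2 := sqint_prox_argument.
  have x'2 := sqint_new_iterate.
  by apply: le_Rintegral => //; exact: integrable_dotv.
- exact: delta_le.
have [->|omega0] := eqVneq omega 0; first by rewrite !mul0r.
apply: ler_wpM2l => //.
have -> : (1 - alpha) * H + alpha * (S + D) = n%:R^-1 * \sum_i
    ((1 - alpha) * edot P (eta i) (eta i)
    + alpha * (edot P (xi i) (xi i) + edot P (phi i) (phi i))).
  by rewrite big_split/= -!mulr_sumr big_split/= /S /D /H; ring.
by rewrite ler_pM2l ?invr_gt0//; apply: ler_sum => i _; exact: shift_edot_le.
Qed.

End new_iterate.

End diana_step.

(** * Assembling the convergence bound *)

Theorem theoremG10
  (R : realType) (m n : nat) (n_gt0 : (0 < n)%N)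
  (Fi : 'I_n -> 'rV[R]_m -> 'rV[R]_m)
  (F : 'rV[R]_m -> 'rV[R]_m)
  (F_average : forall y, F y = average (fun i => Fi i y))
  (reg : 'rV[R]_m -> \bar R)
  (reg_proper : proper_fun reg)
  (reg_lsc : lower_semicontinuous reg)
  (reg_convex : convex_efun reg)
  (xs : 'rV[R]_m)
  (solutions_singleton : VI_solutions F reg = [set xs])
  (mu : R) (mu_gt0 : 0 < mu)
  (F_monotone : quasi_strongly_monotone mu F (VI_solutions F reg))
  (ell : R) (ell_gt0 : 0 < ell)
  (Fi_cocoercive : average_star_cocoercive ell Fi (VI_solutions F reg))
  (omega : R) (omega_ge0 : 0 <= omega)
  (Q : R.-pker 'rV[R]_m ~> 'rV[R]_m)
  (Q_compressor : unbiased_compressor omega Q)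
  (alpha gamma : R)
  (alpha_gt0 : 0 < alpha) (alpha_le : alpha <= 1 / (1 + omega))
  (gamma_gt0 : 0 < gamma)
  (gamma_le : gamma <= 1 / ((1 + 6 * omega / n%:R) * ell))
  (disp : measure_display) (Omega : measurableType disp)
  (P : probability Omega R)
  (past : nat -> set (set Omega))
  (x : nat -> Omega -> 'rV[R]_m)
  (h g q : 'I_n -> nat -> Omega -> 'rV[R]_m)
  (hbar : nat -> Omega -> 'rV[R]_m)
  (iterates : diana_sgda P Q reg gamma alpha past x h g q hbar)
  (sigma : 'I_n -> R)
  (g_unbiased : forall i k,
     is_cond_expectation_rV P (past k) (g i k) (fun w => Fi i (x k w)))
  (g_variance : forall i k,
     cond_expectation_le P (past k)
       (fun w => enorm (g i k w - Fi i (x k w)) ^+ 2) (sigma i ^+ 2)) :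
  let sigma2 := n%:R^-1 * \sum_(i < n) sigma i ^+ 2 in
  let sigma02 := fun w : Omega =>
    n%:R^-1 * \sum_(i < n) enorm (h i 0%N w - Fi i xs) ^+ 2 in
  let V0 := fun w : Omega =>
    enorm (x 0%N w - xs) ^+ 2
    + 4 * omega * gamma ^+ 2 * sigma02 w / (alpha * n%:R) in
  let rho := Num.min (gamma * mu) (alpha / 2) in
  forall k : nat,
    ('E_P[(fun w => enorm (x k w - xs) ^+ 2)%R]
     <= ((1 - rho) ^+ k)%:E * 'E_P[V0]
        + (gamma ^+ 2 * sigma2 * (1 + 5 * omega) / (n%:R * rho))%:E)%E.
Proof.
move=> sigma2 sigma02 V0 rho k.
have filt := diana_filtration iterates.
have sG j : sigma_algebra setT (past j) by case: (filt j).
have Gm j : past j `<=` measurable by case: (filt j).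
have Gx j : measurable_wrt (past j) (x j) by exact: (diana_x_adapted iterates).
have Gh i j : measurable_wrt (past j) (h i j) by exact: (diana_h_adapted
  iterates).
have gS i j : measurable_wrt (past j.+1) (g i j) by exact: (diana_g_adapted
  iterates).
have qS i j : measurable_wrt (past j.+1) (q i j) by exact: (diana_q_adapted
  iterates).
have mx j : measurable_fun setT (x j) := measurable_wrt_sub (Gm j) (Gx j).
have mg i j : measurable_fun setT (g i j) := measurable_wrt_sub (Gm j.+1) (gS i
  j).
have mq i j : measurable_fun setT (q i j) := measurable_wrt_sub (Gm j.+1) (qS i
  j).
have mh i j : measurable_fun setT (h i j) := measurable_wrt_sub (Gm j) (Gh i j).
pose G1 j := <<s past j `|` \bigcup_(l in [set: 'I_n])
  preimage_set_system setT (g l j) measurable >>.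
have sG1 j : sigma_algebra setT (G1 j) by exact: smallest_sigma_algebra.
have G01 j : past j `<=` G1 j.
  by apply: subset_trans (@sub_sigma_algebra _ _ _) => A; left.
have G1m j : G1 j `<=` measurable.
  apply: smallest_sub; first exact: sigma_algebra_measurable.
  by move=> A [/Gm//|[l _ /gS /Gm]].
have G1g i j : measurable_wrt (G1 j) (g i j).
  by apply: subset_trans (@sub_sigma_algebra _ _ _) => A gA; right; exists i.
have hbarE j w : hbar j w = average (fun i => h i j w).
  elim: j => [|j ih]; first exact: diana_hbar0 iterates w.
  rewrite (diana_hbar_step iterates) ih -averageZ -averageD.
  by congr average; apply/funext => i; rewrite (diana_h_step iterates).
have xs_sol : VI_solutions F reg xs by rewrite solutions_singleton.
rewrite solutions_singleton in F_monotone Fi_cocoercive.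
have n0 : (0 : R) < n%:R by rewrite ltr0n.
have rho_le1 : rho <= gamma * mu by rewrite ge_min lexx.
have rho_le2 : rho <= alpha / 2 by rewrite ge_min lexx orbT.
have rho_gt0 : 0 < rho by rewrite lt_min mulr_gt0 ?divr_gt0.
have rho_lt1 : rho < 1.
  apply: le_lt_trans rho_le2 _; rewrite ltr_pdivrMr// mul1r.
  apply: le_lt_trans alpha_le _; rewrite ltr_pdivrMr ?ltr_pwDl//; lra.
pose X j w := x j w - xs.
pose E i j w := h i j w - Fi i xs.
pose M r := 4 * omega * gamma ^+ 2 * r / (alpha * n%:R).
(* A real number in all cases: if [omega = 0], the factor M annihilates whatever value [edot] takes
   on shifts that are not square integrable. *)
pose V j := edot P (X j) (X j) + M (n%:R^-1 * \sum_i edot P (E i j) (E i j)).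
pose c := gamma ^+ 2 * sigma2 * (1 + 5 * omega) / n%:R.
have c_ge0 : 0 <= c.
  apply: divr_ge0 => //; apply: mulr_ge0; last lra.
  apply: mulr_ge0; first exact: sqr_ge0.
  by apply: mulr_ge0; [rewrite invr_ge0|apply: sumr_ge0 => i _; exact: sqr_ge0].
have M_ge0 r : 0 <= r -> 0 <= M r.
  by move=> r0; rewrite /M divr_ge0 ?mulr_ge0 ?sqr_ge0// ltW.
have H_ge0 j : 0 <= n%:R^-1 * \sum_i edot P (E i j) (E i j).
  by apply: mulr_ge0; [rewrite invr_ge0|apply: sumr_ge0 => i _;
    exact: edot_ge0].
(* Square integrability belongs to the induction, since the decrease of V is only established under
   it. *)
have step j : sqint_rV P (X j) -> (omega != 0 -> forall i, sqint_rV P (E i j))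
  ->
    [/\ sqint_rV P (X j.+1), omega != 0 -> forall i, sqint_rV P (E i j.+1)
      & V j.+1 <= (1 - rho) * V j + c].
  move=> X2 E2.
  have x_le w : dotv (X j.+1 w) (X j.+1 w) <=
      let z := x j w - gamma *: (average (fun i => h i j w) + average (fun i =>
        q i j w))
           - (xs - gamma *: F xs) in dotv z z.
    rewrite -hbarE; apply: prox_sqdist_solution reg_proper reg_convex gamma_gt0
      xs_sol _.
    exact: (diana_x_step iterates).
  have G0x := (measurable_wrt_rVP (sG j) _).2 (Gx j).
  have G0h i := (measurable_wrt_rVP (sG j) _).2 (Gh i j).
  have G1g' i := (measurable_wrt_rVP (sG1 j) _).2 (G1g i j).
  have gu i := g_unbiased i j.
  have gv i := g_variance i j.
  have gi := diana_g_independent iterates j.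
  have ql i := diana_q_law iterates i j.
  have qi := diana_q_independent iterates j.
  have ES i : E i j.+1 = fun w => h i j w + alpha *: q i j w - Fi i xs.
    by apply/funext => w; rewrite /E (diana_h_step iterates).
  split.
  - exact: (sqint_new_iterate n_gt0 F_average Fi_cocoercive omega_ge0
    Q_compressor
      (sG j) (sG1 j) (G01 j) (G1m j) G0h G1g' (fun i => mq i j) ql gu gv X2 E2
      (mx j.+1) x_le).
  - move=> omega0 i; rewrite ES.
    exact: (sqint_new_shift n_gt0 F_average Fi_cocoercive alpha omega_ge0
      Q_compressor
      (sG j) (sG1 j) (G01 j) (G1m j) G0h G1g' (fun i => mq i j) ql gu gv X2 E2
        i omega0).
  - rewrite {1}/V (eq_bigr _ (fun i _ => congr1 (fun u => edot P u u) (ES i))).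
    exact: (diana_step_le n_gt0 F_average mu_gt0 ell_gt0 F_monotone
      Fi_cocoercive
      omega_ge0 Q_compressor alpha_gt0 alpha_le (sG j) (sG1 j) (G01 j) (G1m j)
      G0x G0h G1g' (fun i => mg i j) (fun i => mq i j) gi ql qi gu gv X2 E2
      gamma_gt0 gamma_le rho_le1 rho_le2 (mx j.+1) x_le).
pose kappa := 4 * omega * gamma ^+ 2 / (alpha * n%:R).
have ME r : M r = kappa * r by rewrite /M /kappa mulrAC.
have V0E : V0 = fun w => dotv (X 0%N w) (X 0%N w)
    + kappa * n%:R^-1 * \sum_i dotv (E i 0%N w) (E i 0%N w).
  apply/funext => w; rewrite /V0 -/(M _) ME enorm_sqr /sigma02 mulrA.
  by under eq_bigr do rewrite enorm_sqr.
have kappa_ge0 : 0 <= kappa by rewrite -[kappa]mulr1 -ME; exact: M_ge0.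
have V0_ge w : dotv (X 0%N w) (X 0%N w) <= V0 w.
  rewrite V0E lerDl; apply: mulr_ge0; first by rewrite mulr_ge0// invr_ge0.
  by apply: sumr_ge0 => i _; exact: dotv_ge0.
have V0_ge0 w : 0 <= V0 w := le_trans (dotv_ge0 _) (V0_ge w).
have GX : measurable_wrt_rV (past 0%N) (X 0%N).
  apply: (measurable_wrt_rVB (sG 0%N)).
    exact/(measurable_wrt_rVP (sG 0%N)).
  exact: (measurable_wrt_rV_cst (sG 0%N)).
have GE i : measurable_wrt_rV (past 0%N) (E i 0%N).
  apply: (measurable_wrt_rVB (sG 0%N)).
    exact/(measurable_wrt_rVP (sG 0%N)).
  exact: (measurable_wrt_rV_cst (sG 0%N)).
have mX : measurable_fun setT (X 0%N).
  exact: (measurable_wrt_sub (Gm 0%N) ((measurable_wrt_rVP (sG 0%N) _).1 GX)).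
have mE i : measurable_fun setT (E i 0%N).
  exact: (measurable_wrt_sub (Gm 0%N) ((measurable_wrt_rVP (sG 0%N) _).1 (GE
    i))).
have mV0 : measurable_fun setT V0.
  rewrite V0E; apply: measurable_funD; first exact: measurable_dotv.
  by apply: measurable_funM => //; apply: measurable_sum => i;
    exact: measurable_dotv.
have E_V0 : ('E_P[V0] = \int[P]_w (V0 w)%:E)%E by rewrite unlock.
(* Since 1 - rho > 0, an infinite E[V_0] makes the right-hand side infinite. *)
have [V0y|V0fin] := eqVneq ('E_P[V0])%E +oo%E.
  rewrite V0y gt0_muley ?lte_fin ?exprn_gt0 ?subr_gt0// addye ?leey//.
have iV0 : P.-integrable setT (EFin \o V0).
  apply/integrableP; split; first exact/measurable_EFinP.
  under eq_integral do rewrite /= ger0_norm//.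
  by rewrite -E_V0 ltey.
have X2 : sqint_rV P (X 0%N).
  apply: le_sqint_rV iV0 => // j.
  exact: (measurableT_comp (measurable_coord j) mX).
(* [V0] dominates kappa / n times each |E_i|^2, and kappa > 0 when omega is not 0. *)
have E2 : omega != 0 -> forall i, sqint_rV P (E i 0%N).
  move=> omega0 i.
  have kappa_gt0 : 0 < kappa.
    by rewrite divr_gt0 ?mulr_gt0// ?exprn_gt0// lt_neqAle eq_sym omega0.
  have := integrableZl measurableT (n%:R / kappa) iV0; rewrite /comp.
  under eq_fun do rewrite -EFinM.
  apply: le_sqint_rV => [j|w].
    exact: (measurableT_comp (measurable_coord j) (mE i)).
  rewrite V0E mulrDr -[leLHS]add0r lerD//.
    by rewrite mulr_ge0 ?dotv_ge0// divr_ge0// ltW.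
  rewrite [leRHS]mulrA.
  have -> : n%:R / kappa * (kappa * n%:R^-1) = 1 by field; rewrite !gt_eqF.
  rewrite mul1r (bigD1 i)//= lerDl.
  by apply: sumr_ge0 => l _; exact: dotv_ge0.
have VE : 'E_P[V0]%E = (V 0%N)%:E.
  rewrite E_V0 -EFin_Rintegral// /V ME; congr EFin.
  (* For [omega = 0] the coefficient kappa vanishes, so the integral of the shifts does not have to
     be split off. *)
  have [omega0|omega0] := eqVneq omega 0.
    have k0 : kappa = 0 by rewrite /kappa omega0 mulr0 !mul0r.
    rewrite k0 mul0r addr0; apply: eq_Rintegral => w _.
    by rewrite V0E k0 !mul0r addr0.
  have [iE IE] := edot_average (kappa * n%:R^-1) (E2 omega0).
  rewrite V0E RintegralD//; last exact: integrable_dotv.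
  by rewrite IE mulrA.
(* c / rho is the fixed point of v -> (1 - rho) v + c. *)
have [Xk2 _ Vk] : [/\ sqint_rV P (X k), omega != 0 -> forall i, sqint_rV P (E i
  k)
    & V k <= (1 - rho) ^+ k * V 0%N + c / rho].
  elim: k => [|j [Xj Ej Vj]].
    by split=> //; rewrite expr0 mul1r lerDl divr_ge0// ltW.
  have [XS ES VS] := step j Xj Ej; split=> //; apply: le_trans VS _.
  apply: (@le_trans _ _ ((1 - rho) * ((1 - rho) ^+ j * V 0%N + c / rho) + c)).
    by rewrite lerD2r ler_wpM2l// subr_ge0 ltW.
  rewrite le_eqVlt; apply/orP; left; apply/eqP.
  by rewrite exprS; field; exact: lt0r_neq0.
rewrite VE -EFinM -EFinD.
have -> : ('E_P[(fun w => enorm (x k w - xs) ^+ 2)%R] = (edot P (X k) (X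
  k))%:E)%E.
  rewrite unlock /edot EFin_Rintegral; [|by []|exact: integrable_dotv].
  by apply: eq_integral => w _; rewrite enorm_sqr.
(* The shift part of [V k] is nonnegative and is dropped. *)
rewrite lee_fin; have := M_ge0 _ (H_ge0 k); move: Vk; rewrite {1}/V.
have -> : gamma ^+ 2 * sigma2 * (1 + 5 * omega) / (n%:R * rho) = c / rho.
  by rewrite /c; field; rewrite !gt_eqF.
lra.
Qed.
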